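(* Let $n$ be a positive integer, $\alpha>n/2$, and let $X=\{\mathbf{x}_j\in\mathbb{R}^n: j\in\mathbb{N}\}$ be a set of distinct points with $\delta(X)=\inf_{j\neq k}|\mathbf{x}_j-\mathbf{x}_k|>0$. (i) If $n\ge 2$, then $\{G_\alpha(\mathbf{x}-\mathbf{x}_j)\}_{j\in\mathbb{N}}$ is a Riesz sequence in the Sobolev space $H^\alpha(\mathbb{R}^n)$. (ii) If $n=1$ and $\delta(X)> \frac{4\,\Gamma(\alpha)\Gamma(1/2)}{\Gamma(\alpha-1/2)}$, then $\{G_\alpha(x-x_j)\}_{j\in\mathbb{N}}$ is a Riesz sequence in $H^\alpha(\mathbb{R})$.
   Context: For $\gamma>0$, $G_\gamma(\mathbf{x})=G_\gamma(|\mathbf{x}|)$ with $G_\gamma(z)=\frac{1}{2^{\gamma-1+\frac n2}\pi^{\frac n2}\Gamma(\gamma)}K_{\gamma-\frac n2}(z)z^{\gamma-\frac n2}$ for $z>0$ (value at $0$ by continuity when $\gamma>n/2$), $K_\nu$ being the modified Bessel function of the second kind. With $\widehat u(\xi)=\int_{\mathbb{R}^n}e^{-i\xi\cdot\mathbf{x}}u(\mathbf{x})d\mathbf{x}$, $H^\alpha(\mathbb{R}^n)=\{u\in L^2(\mathbb{R}^n):\int(1+|\xi|^2)^\alpha|\widehat u(\xi)|^2d\xi<\infty\}$ with inner product $(u,v)_{H^\alpha}=(2\pi)^{-n}\int\widehat u(\xi)\overline{\widehat v(\xi)}(1+|\xi|^2)^\alpha d\xi$. A system $\{f_j\}$ in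 a Hilbert space $H$ is a Riesz sequence if there are $0<A\le B<\infty$ with $A\sum_j|c_j|^2\le\|\sum_jc_jf_j\|_H^2\le B\sum_j|c_j|^2$ for all finitely supported complex sequences $(c_j)$ (equivalently, its Gramian matrix defines a bounded invertible operator on $\ell^2(\mathbb{N})$). *)

(* Defs.v *)
From HB Require Import structures.
From mathcomp Require Import all_boot all_order all_algebra.
From mathcomp Require Import all_classical all_reals all_analysis.
From mathcomp Require Import complex.

Set Implicit Arguments.
Unset Strict Implicit.
Unset Printing Implicit Defensive.

Import Order.TTheory GRing.Theory Num.Theory.
Import numFieldNormedType.Exports.
Local Open Scope classical_set_scope.
Local Open Scope ring_scope.

Section Defs.
Variable R : realType.

Definition dotn (n : nat) (x y : n.-tuple R) : R :=
  \sum_(i < n) tnth x i * tnth y i.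
Definition enorm (n : nat) (x : n.-tuple R) : R := Num.sqrt (dotn x x).
Definition tsub (n : nat) (x y : n.-tuple R) : n.-tuple R :=
  [tuple tnth x i - tnth y i | i < n].

(* Lebesgue integral over R^n, written as the iterated one-dimensional
   Lebesgue integral (Fubini--Tonelli), first coordinate outermost. *)
Fixpoint iint (n : nat) : (n.-tuple R -> \bar R) -> \bar R :=
  match n return (n.-tuple R -> \bar R) -> \bar R with
  | 0 => fun f => f [tuple]
  | n'.+1 => fun f =>
      (\int[@lebesgue_measure R]_(x in [set: R])
          iint (fun t : n'.-tuple R => f [tuple of x :: t]))%E
  end.

Definition cabs2 (z : R[i]) : R := complex.Re z ^+ 2 + complex.Im z ^+ 2.
Definition expmi (theta : R) : R[i] := Complex (cos theta) (- sin theta).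

Definition fourier (n : nat) (u : n.-tuple R -> R[i]) (xi : n.-tuple R) : R[i] :=
  Complex
    (fine (iint (fun x => (complex.Re (expmi (dotn xi x) * u x))%:E)))
    (fine (iint (fun x => (complex.Im (expmi (dotn xi x) * u x))%:E))).

Definition Hnorm2 (alpha : R) (n : nat) (u : n.-tuple R -> R[i]) : \bar R :=
  (((2 * pi) ^- n)%:E *
   iint (fun xi => (cabs2 (fourier u xi) * (1 + enorm xi ^+ 2) `^ alpha)%:E))%E.

Definition in_H (alpha : R) (n : nat) (u : n.-tuple R -> R[i]) : Prop :=
  [/\ measurable_fun [set: n.-tuple R] (fun x => complex.Re (u x)),
      measurable_fun [set: n.-tuple R] (fun x => complex.Im (u x)),
      (iint (fun x => (cabs2 (u x))%:E) < +oo)%E &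
      (Hnorm2 alpha u < +oo)%E].

Definition lincomb (n : nat) (N : nat) (c : nat -> R[i])
  (f : nat -> n.-tuple R -> R[i]) (x : n.-tuple R) : R[i] :=
  \sum_(j < N) c j * f j x.
Definition sqsum (N : nat) (c : nat -> R[i]) : R := \sum_(j < N) cabs2 (c j).

(* Riesz sequence in H^alpha (finitely supported coefficient sequences are
   those vanishing from some index N on). *)
Definition riesz_seq_H (alpha : R) (n : nat) (f : nat -> n.-tuple R -> R[i]) : Prop :=
  (forall j, in_H alpha (f j)) /\
  exists A B : R, [/\ 0 < A, A <= B &
    forall (N : nat) (c : nat -> R[i]),
      ((A * sqsum N c)%:E <= Hnorm2 alpha (lincomb N c f))%E /\
      (Hnorm2 alpha (lincomb N c f) <= (B * sqsum N c)%:E)%E].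

Definition Gamma (g : R) : R :=
  fine (\int[@lebesgue_measure R]_(t in (`]0%R, +oo[%classic : set R))
          ((t `^ (g - 1)) * expR (- t))%:E)%E.

Definition coshR (t : R) : R := (expR t + expR (- t)) / 2.

Definition besselK (nu z : R) : R :=
  fine (\int[@lebesgue_measure R]_(t in (`[0%R, +oo[%classic : set R))
          (expR (- (z * coshR t)) * coshR (nu * t))%:E)%E.

Definition Gpos (n : nat) (g z : R) : R :=
  (2 `^ (g - 1 + n%:R / 2) * pi `^ (n%:R / 2) * Gamma g)^-1
  * besselK (g - n%:R / 2) z * z `^ (g - n%:R / 2).

Definition Gker (n : nat) (g z : R) : R :=
  if 0 < z then Gpos n g z else lim (Gpos n g @ 0^'+).

Definition sepdist (n : nat) (xs : nat -> n.-tuple R) : R :=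
  inf [set d | exists j k : nat, j <> k /\ d = enorm (tsub (xs j) (xs k))].

End Defs.

(* Main.v *)
Require Import Defs.
From HB Require Import structures.
From mathcomp Require Import all_boot all_order all_algebra.
From mathcomp Require Import all_classical all_reals all_analysis.
From mathcomp Require Import measurable_realfun complex ring lra.
Import Order.TTheory GRing.Theory Num.Theory.
Import numFieldNormedType.Exports.

Set Implicit Arguments.
Unset Strict Implicit.
Unset Printing Implicit Defensive.

Local Open Scope classical_set_scope.
Local Open Scope ring_scope.

(** Up to constants, [Gker n alpha z] is [bpot nu z = \int exp(nu u - e^u - z^2 e^-u / 4) du]
    with [nu = alpha - n/2 > 0], a mixture of Gaussians with mixing variable [t = e^u]; hence
    its Fourier transform is a constant times [(1 + |xi|^2)^-alpha], and the squared
    [H^alpha] norm of [\sum_j c_j G(x - x_j)] is a constant times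
    [\int |\sum_j c_j e^(-i xi.x_j)|^2 (1 + |xi|^2)^-alpha dxi]
    [= const * \sum_jk Re(c_j c_k^* ) bpot nu |x_j - x_k|].
    The upper Riesz bound is Schur's test: [bpot nu] decays exponentially and the points are
    separated.  For the lower bound, [(1 + |xi|^2)^-alpha] dominates a multiple of
    [exp(- eps |xi|^2)] for every [eps > 0]; the quadratic form of this Gaussian has entries
    proportional to [exp(- |x_j - x_k|^2 / (4 eps))], so it is diagonally dominant when [eps]
    is small.  This works in every dimension and for every positive separation. *)

(** * Integration on the real line *)

(** Writing the mixing variable as [t = exp u] puts the mixtures on the whole line: powers of [t]
    become exponentials, dilations become translations, and nothing singular remains at an endpoint.
    The obstacle is that [iint] is an iterated integral rather than an integral against a product
    measure, so additivity and Fubini have to be earned coordinate by coordinate. The Fourier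
    transform is therefore computed in real form, as cosines with a free phase, for a finite family
    of mixtures at once, by induction on the dimension with one two-variable Fubini argument per
    step. The resulting formula serves with three Gaussian rates [c u]: [exp (- u) / 4] for the
    transform of the kernel, [exp u] for the surviving weight [(1 + |xi|^2)^-alpha], and a constant
    for the Gaussian minorant. The minorant is compared with the weight under [iint], where
    monotonicity on nonnegative integrands suffices. *)

Section RealLine.
Variable R : realType.
Notation mu := (@lebesgue_measure R).
Implicit Types (f g h : R -> R) (a b c x y u : R).

Let measurable_shift a : measurable_fun [set: measurableTypeR R]
  ((fun x => x + a) : measurableTypeR R -> measurableTypeR R).
Proof. exact: measurable_funD. Qed.

Let shift_mixin a := isMeasurableFun.Build _ _ _ _ _ (measurable_shift a).
Let shift_mfun a : {mfun measurableTypeR R >-> measurableTypeR R} :=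
  HB.pack ((fun x => x + a) : measurableTypeR R -> measurableTypeR R)
          (shift_mixin a).

Lemma lebesgue_measure_shift a (A : set R) : measurable A ->
  pushforward mu (shift_mfun a) A = mu A.
Proof.
move=> mA; apply/esym/lebesgue_measure_unique => //= _ [[b c]] _ <-.
rewrite /pushforward.
rewrite (_ : _ @^-1` _ = `](b - a), (c - a)]%classic); last first.
  by apply/seteqP; split => x /=; rewrite !in_itv/= ltrBlDr lerBrDr.
rewrite !lebesgue_measure_itv/= !lte_fin ltrD2r.
by case: ifP => // _; rewrite -!EFinB; congr (_%:E); ring.
Qed.

Lemma ge0_integral_shift (f : R -> \bar R) a :
  measurable_fun [set: R] f -> (forall x, 0 <= f x)%E ->
  (\int[mu]_x f (x + a)%R = \int[mu]_x f x)%E.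
Proof.
move=> mf f0.
rewrite -[RHS](@eq_measure_integral _ _ _ _ _ (pushforward mu (shift_mfun a))); last first.
  by move=> A mA _; exact: lebesgue_measure_shift.
by rewrite ge0_integral_pushforward//= ?preimage_setT.
Qed.

Lemma integral_shift (f : R -> \bar R) a :
  measurable_fun [set: R] f ->
  (\int[mu]_x f (x + a)%R = \int[mu]_x f x)%E.
Proof.
move=> mf; rewrite integralE [RHS]integralE.
rewrite -(@ge0_integral_shift (funepos f) a); [|exact: measurable_funepos|by []].
rewrite -(@ge0_integral_shift (funeneg f) a); [|exact: measurable_funeneg|by []].
by congr (_ - _)%E; apply: eq_integral => x _; rewrite unlock.
Qed.

(** Since [u] is the logarithm of the mixing variable, translation replaces most changes of
    variables: it gives the scaling of Gamma integrals and the passage to the Bessel function. *)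
Lemma Rintegral_shift f a : measurable_fun [set: R] f ->
  \int[mu]_x f (x + a) = \int[mu]_x f x.
Proof.
move=> mf; congr fine; apply: (@integral_shift (EFin \o f)).
exact/measurable_EFinP.
Qed.

Lemma le_integrableR f g : measurable_fun [set: R] f ->
  (forall x, `|f x| <= g x) -> mu.-integrable setT (EFin \o g) ->
  mu.-integrable setT (EFin \o f).
Proof.
move=> mf fg ig; apply: (le_integrable _ _ _ ig) => //.
  exact/measurable_EFinP.
by move=> x _; rewrite /= lee_fin (le_trans (fg x))// ler_norm.
Qed.

Lemma le_abs_integrableR f g : measurable_fun [set: R] f ->
  (forall x, `|f x| <= `|g x|) -> mu.-integrable setT (EFin \o g) ->
  mu.-integrable setT (EFin \o f).
Proof.
move=> mf fg ig; apply: (le_integrable _ _ _ ig) => //.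
  exact/measurable_EFinP.
by move=> x _; rewrite /= lee_fin.
Qed.

Lemma integrableR_Zl f k : mu.-integrable setT (EFin \o f) ->
  mu.-integrable setT (EFin \o (fun x => k * f x)).
Proof.
by move=> fi; have := @integrableZl _ _ _ mu _ measurableT k _ fi;
  apply: eq_integrable => // x _ /=; rewrite EFinM.
Qed.

Lemma integrableR_D f g : mu.-integrable setT (EFin \o f) ->
  mu.-integrable setT (EFin \o g) ->
  mu.-integrable setT (EFin \o (fun x => f x + g x)).
Proof. by move=> fi gi; exact: (@integrableD _ _ _ mu _ measurableT _ _ fi gi). Qed.

Lemma integrableR_shift f a : mu.-integrable setT (EFin \o f) ->
  mu.-integrable setT (EFin \o (fun x => f (x + a))).
Proof.
move=> /integrableP[mf fi]; apply/integrableP; split.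
  by apply: (measurableT_comp mf); exact: measurable_funD.
by rewrite (@integral_shift (fun x => `|(f x)%:E|)%E a)//; apply: measurableT_comp.
Qed.

(** A zero integral would make [f] vanish almost everywhere on [D], so [D] would be null. This is
    what makes the normalising constants positive. *)
Lemma Rintegral_gt0 (D : set R) f : measurable D -> (0 < mu D)%E ->
  measurable_fun D f -> (forall x, D x -> 0 < f x) ->
  mu.-integrable D (EFin \o f) -> 0 < \int[mu]_(x in D) f x.
Proof.
move=> mD D0 mf f0 fi.
rewrite lt_neqAle Rintegral_ge0 ?andbT; last by move=> x Dx; exact/ltW/f0.
apply/eqP => H.
have : (\int[mu]_(x in D) `|(f x)%:E| = 0)%E.
  transitivity (\int[mu]_(x in D) (f x)%:E)%E.
    by apply: eq_integral => x /set_mem Dx; rewrite gee0_abs// lee_fin ltW// f0.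
  rewrite -[LHS]fineK; last exact: integrable_fin_num.
  by congr EFin; rewrite H.
move=> /ae_eq_integral_abs-/(_ mD).
case; first exact/measurable_EFinP.
move=> N [mN N0 sN].
have : (mu D <= mu N)%E.
  apply: le_measure; rewrite ?inE//.
  by move=> x Dx; apply: sN => /= /(_ Dx) [] /eqP; rewrite gt_eqF// f0.
by rewrite [mu N]N0 leNgt D0.
Qed.

Lemma lebesgue_measureT_gt0 : (0 < mu setT)%E.
Proof. by rewrite -set_itvNyy lebesgue_measure_itv/= ltry. Qed.

Lemma ge0_integral_opp (f : R -> \bar R) :
  measurable_fun [set: R] f -> (forall x, 0 <= f x)%E ->
  (\int[mu]_x f (- x)%R = \int[mu]_x f x)%E.
Proof.
move=> mf f0.
rewrite -[RHS](@eq_measure_integral _ _ _ _ _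
  (pushforward mu (-%R : _ -> measurableTypeR R))); last first.
  by move=> A mA _; exact: lebesgue_measureN.
by rewrite ge0_integral_pushforward//= ?preimage_setT.
Qed.

Lemma integrableR_ge0P f : measurable_fun [set: R] f -> (forall x, 0 <= f x) ->
  (\int[mu]_x (f x)%:E < +oo)%E -> mu.-integrable setT (EFin \o f).
Proof.
move=> mf f0 fi; apply/integrableP; split; first exact/measurable_EFinP.
by under eq_integral do rewrite /= ger0_norm//.
Qed.

Lemma integral_gauss_fun c a : 0 < c ->
  (\int[mu]_x (expR (- (c * (x - a) ^+ 2)))%:E = (Num.sqrt (pi / c))%:E)%E.
Proof.
move=> c0; pose s := (Num.sqrt (2 * c))^-1.
have c2 : 0 < 2 * c by lra.
have s0 : s != 0 by rewrite invr_eq0 gt_eqF ?sqrtr_gt0.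
have := integral_normal_pdf a s.
rewrite normal_pdfE//.
have s2 : s ^+ 2 *+ 2 = c^-1.
  by rewrite /s exprVn sqr_sqrtr ?ltW// -mulr_natr; field; rewrite gt_eqF.
under eq_integral do rewrite EFinM.
rewrite ge0_integralZl//; last 3 first.
- by apply/measurable_EFinP; exact: measurable_normal_fun.
- by move=> x _; rewrite lee_fin expR_ge0.
- by rewrite lee_fin normal_peak_ge0.
have -> : (fun x => (normal_fun a s x)%:E) =
   (fun x => (expR (- (c * (x - a) ^+ 2)))%:E).
  by apply/funext => x; rewrite /normal_fun /= s2 invrK mulNr mulrC.
have -> : normal_peak s = (Num.sqrt (pi / c))^-1.
  by rewrite /normal_peak -mulrnAl s2 mulrC.
have q0 : 0 < Num.sqrt (pi / c) by rewrite sqrtr_gt0 divr_gt0 ?pi_gt0.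
(* The normalisation of the density is an identity in extended reals; infinite values are excluded
   because a positive multiple of them cannot be 1. *)
move: (\int[_]_ _ _)%E => [r|//|//] /=.
- move=> [] /(congr1 (fun y => Num.sqrt (pi / c) * y)).
  by rewrite mulrA divff ?gt_eqF// mul1r mulr1 => ->.
- by rewrite gt0_muley// lte_fin invr_gt0.
- by rewrite gt0_muleNy// lte_fin invr_gt0.
Qed.

Lemma measurable_gauss c a :
  measurable_fun [set: R] (fun x => expR (- (c * (x - a) ^+ 2))).
Proof.
apply: measurableT_comp => //; apply: measurableT_comp => //.
apply: measurable_funM => //; apply: measurable_funX; exact: measurable_funB.
Qed.

Lemma integrable_gauss c a : 0 < c ->
  mu.-integrable setT (EFin \o (fun x => expR (- (c * (x - a) ^+ 2)))).
Proof.
move=> c0; apply: integrableR_ge0P => [|x|]; first exact: measurable_gauss.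
  exact: expR_ge0.
by rewrite integral_gauss_fun// ltry.
Qed.

End RealLine.

(** * Fourier transform of a Gaussian *)

Section GaussFourier.
Variable R : realType.
Notation mu := (@lebesgue_measure R).
Implicit Types (f g h : R -> R) (a b c x y u : R).

Lemma is_derive_gauss_phase_freq (p c y xi : R) : c != 0 ->
  is_derive xi (1 : R)
    (fun xi => expR (xi ^+ 2 / (4 * c)) * cos (p + xi * y) * expR (- (c * y ^+ 2)))
    ((2 * c)^-1 * expR (xi ^+ 2 / (4 * c)) *
     (xi * cos (p + xi * y) - 2 * c * y * sin (p + xi * y)) *
     expR (- (c * y ^+ 2))).
Proof.
move=> c0; apply: is_derive_eq.
rewrite /GRing.scale/=.
by field.
Qed.

(** For [k = (2 * c)^-1 * expR (xi ^+ 2 / (4 * c))] this is exactly the frequency derivative of the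
    preceding lemma, which is thus a total derivative in position. *)
Lemma is_derive_gauss_phase_pos (p c k xi x a : R) :
  is_derive x (1 : R)
    (fun x => k * sin (p + xi * (x - a)) * expR (- (c * (x - a) ^+ 2)))
    (k * (xi * cos (p + xi * (x - a)) - 2 * c * (x - a) * sin (p + xi * (x - a))) *
     expR (- (c * (x - a) ^+ 2))).
Proof.
apply: is_derive_eq.
rewrite /GRing.scale/=.
ring.
Qed.

(** By translation invariance the integral of [h (x + t)] does not depend on [t]; differentiating
    under the integral at [t = 0] gives the claim without boundary terms. [G] has to dominate [h']
    on a unit window around each point. *)
Lemma Rintegral_derive_eq0 h (h' G : R -> R) :
  (forall x, is_derive x (1 : R) h (h' x)) ->
  (forall x t, `|t| < 1 -> `|h' (x + t)| <= G x) ->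
  mu.-integrable setT (EFin \o h) -> mu.-integrable setT (EFin \o G) ->
  \int[mu]_x h' x = 0.
Proof.
move=> dh hG ih iG.
have mh : measurable_fun [set: R] h by have /integrableP[/measurable_EFinP] := ih.
have dsh t y : is_derive t (1 : R) (fun t => h (y + t)) (h' (y + t)).
  rewrite -[h' (y + t)]mulr1; apply: (@is_derive1_comp _ h (fun t => y + t)).
  rewrite -[1 in X in is_derive _ _ _ X]add0r.
  exact: (is_deriveD (is_derive_cst y t 1) (is_derive_id t 1)).
have E : partial1of2 (fun t y => h (y + t)) = (fun t y => h' (y + t)).
  apply/funext => t; apply/funext => y.
  by rewrite partial1of2E; have := dsh t y => ?; exact: derive_val.
have := @differentiation_under_integral R _ _ mu (fun t y => h (y + t)) setT
  measurableT 0 (-1) 1 _ _ _ G _ iG _.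
rewrite E /=.
have -> : (fun t => \int[mu]_y h (y + t)) = cst (\int[mu]_y h y).
  by apply/funext => t; rewrite Rintegral_shift.
rewrite derive1_cst => H.
rewrite [RHS]H; first by apply: eq_Rintegral => x _; rewrite addr0.
- by rewrite /= in_itv/= ltrN10 ltr01.
- by move=> t _; exact: integrableR_shift.
- by move=> x y _ _; have := dsh x y => -[].
- by move=> y; apply: le_trans (hG y 0 _); rewrite ?normr0.
- move=> x y; rewrite /= in_itv/= => /andP[x1 x2] _; apply: hG.
  by rewrite ltr_norml x1.
Qed.

(** Half of the exponent is kept as decay; the other half absorbs [|y|] through [exp v >= 1 + v]. *)
Lemma ler_norm_expR_sqr c y : 0 < c ->
  `|y| * expR (- (c * y ^+ 2)) <= (c^-1 + 1) * expR (- (c / 2 * y ^+ 2)).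
Proof.
move=> c0.
have -> : - (c * y ^+ 2) = - (c / 2 * y ^+ 2) + - (c / 2 * y ^+ 2) by field.
rewrite expRD mulrA ler_wpM2r ?expR_ge0// expRN ler_pdivrMr ?expR_gt0//.
have ci : 0 < c^-1 by rewrite invr_gt0.
apply: (@le_trans _ _ ((c^-1 + 1) * (1 + c / 2 * y ^+ 2))); last first.
  by rewrite ler_wpM2l ?expR_ge1Dx//; lra.
have -> : (c^-1 + 1) * (1 + c / 2 * y ^+ 2) =
   c^-1 + c / 2 * y ^+ 2 + 1 + 2^-1 * y ^+ 2 by field; rewrite gt_eqF.
have : 0 <= c / 2 * y ^+ 2 by rewrite mulr_ge0 ?sqr_ge0//; lra.
by rewrite -real_normK ?num_real//; have := sqr_ge0 (`|y| - 1); nra.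
Qed.

Lemma measurable_phase (p xi a : R) :
  measurable_fun [set: R] (fun x => p + xi * (x - a)).
Proof.
by apply: measurable_funD => //; apply: measurable_funM => //; exact: measurable_funB.
Qed.

Lemma measurable_cosR : measurable_fun [set: R] (@cos R).
Proof. by apply: continuous_measurable_fun; exact: continuous_cos. Qed.

Lemma measurable_sinR : measurable_fun [set: R] (@sin R).
Proof. by apply: continuous_measurable_fun; exact: continuous_sin. Qed.

Lemma measurable_cos_gauss p c xi a : measurable_fun [set: R]
  (fun x => cos (p + xi * (x - a)) * expR (- (c * (x - a) ^+ 2))).
Proof.
apply: measurable_funM; last exact: measurable_gauss.
by apply: (measurableT_comp measurable_cosR); exact: measurable_phase.
Qed.

Lemma measurable_sin_gauss p c xi a : measurable_fun [set: R]
  (fun x => sin (p + xi * (x - a)) * expR (- (c * (x - a) ^+ 2))).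
Proof.
apply: measurable_funM; last exact: measurable_gauss.
by apply: (measurableT_comp measurable_sinR); exact: measurable_phase.
Qed.

Lemma norm_cos_le1 (x : R) : `|cos x| <= 1.
Proof. by rewrite ler_norml cos_geN1 cos_le1. Qed.

Lemma norm_sin_le1 (x : R) : `|sin x| <= 1.
Proof. by rewrite ler_norml sin_geN1 sin_le1. Qed.

Lemma integrable_cos_gauss p c xi a : 0 < c ->
  mu.-integrable setT
    (EFin \o (fun x => cos (p + xi * (x - a)) * expR (- (c * (x - a) ^+ 2)))).
Proof.
move=> c0; apply: le_integrableR (integrable_gauss a c0).
  exact: measurable_cos_gauss.
by move=> x; rewrite normrM (ger0_norm (expR_ge0 _)) ler_piMl ?expR_ge0 ?norm_cos_le1.
Qed.

Lemma integrable_sin_gauss p c xi a : 0 < c ->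
  mu.-integrable setT
    (EFin \o (fun x => sin (p + xi * (x - a)) * expR (- (c * (x - a) ^+ 2)))).
Proof.
move=> c0; apply: le_integrableR (integrable_gauss a c0).
  exact: measurable_sin_gauss.
by move=> x; rewrite normrM (ger0_norm (expR_ge0 _)) ler_piMl ?expR_ge0 ?norm_sin_le1.
Qed.

Lemma norm_gauss_phase_le (p c xi y : R) : 0 < c ->
  `|(xi * cos (p + xi * y) - 2 * c * y * sin (p + xi * y)) *
    expR (- (c * y ^+ 2))| <=
  (`|xi| + 2 * c * (c^-1 + 1)) * expR (- (c / 2 * y ^+ 2)).
Proof.
move=> c0; rewrite normrM (ger0_norm (expR_ge0 _)).
have c20 : 0 <= 2 * c by lra.
apply: (@le_trans _ _ ((`|xi| + 2 * c * `|y|) * expR (- (c * y ^+ 2)))).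
  rewrite ler_wpM2r ?expR_ge0// (le_trans (ler_normB _ _))// lerD//.
    by rewrite normrM ler_piMr ?norm_cos_le1.
  rewrite normrM (normrM _ y) (ger0_norm c20) ler_piMr ?norm_sin_le1//.
  by apply: mulr_ge0.
rewrite [leLHS]mulrDl [leRHS]mulrDl lerD//.
  by rewrite ler_wpM2l// ler_expR lerN2 ler_wpM2r ?sqr_ge0//; lra.
by rewrite -(mulrA (2 * c) `|y|) -(mulrA (2 * c) (c^-1 + 1)) ler_wpM2l// ler_norm_expR_sqr.
Qed.

Let sin_gauss_derive_integral0 (p c k xi a : R) : 0 < c ->
  \int[mu]_x (k * (xi * cos (p + xi * (x - a)) -
               2 * c * (x - a) * sin (p + xi * (x - a))) *
     expR (- (c * (x - a) ^+ 2))) = 0.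
Proof.
move=> c0.
apply: (@Rintegral_derive_eq0
  (fun x => k * sin (p + xi * (x - a)) * expR (- (c * (x - a) ^+ 2))) _
  (fun x => (`|k| * (`|xi| + 2 * c * (c^-1 + 1)) * expR (c / 2)) *
            expR (- (c / 4 * (x - a) ^+ 2)))).
- by move=> x; exact: is_derive_gauss_phase_pos.
- move=> x t t1; rewrite -mulrA normrM -!(mulrA `|k|) ler_wpM2l//.
  apply: le_trans (norm_gauss_phase_le _ _ _ c0) _.
  have : 0 <= `|xi| + 2 * c * (c^-1 + 1).
    by rewrite addr_ge0// mulr_ge0 ?addr_ge0 ?invr_ge0 ?(ltW c0)//; lra.
  move: (_ + _) => A A0; rewrite -(mulrA A) ler_wpM2l//.
  (* From [(y + t)^2 >= y^2 / 2 - t^2] and [|t| < 1], the rate [c / 2] at the shifted point becomes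
     the rate [c / 4] at [y], at the cost of the factor [exp (c / 2)]. *)
  rewrite -expRD ler_expR.
  have : t ^+ 2 <= 1 by rewrite -real_normK ?num_real// expr_le1// ltW.
  have -> : x + t - a = (x - a) + t by ring.
  move: (x - a) => y.
  have := sqr_ge0 (y / 2 + t).
  nra.
- under [X in EFin \o X]eq_fun do rewrite -mulrA.
  by apply: integrableR_Zl; exact: integrable_sin_gauss.
- by apply: integrableR_Zl; apply: integrable_gauss; lra.
Qed.

Let gauss_phase (p c a xi x : R) :=
  expR (xi ^+ 2 / (4 * c)) * cos (p + xi * (x - a)) * expR (- (c * (x - a) ^+ 2)).

Let gauss_phase' (p c a xi x : R) := (2 * c)^-1 * expR (xi ^+ 2 / (4 * c)) *
  (xi * cos (p + xi * (x - a)) - 2 * c * (x - a) * sin (p + xi * (x - a))) *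
  expR (- (c * (x - a) ^+ 2)).

Let integrable_gauss_phase p c a xi : 0 < c ->
  mu.-integrable setT (EFin \o gauss_phase p c a xi).
Proof.
move=> c0; rewrite /gauss_phase.
under [X in EFin \o X]eq_fun do rewrite -mulrA.
by apply: integrableR_Zl; exact: integrable_cos_gauss.
Qed.

Let is_derive_integral_gauss_phase p c a xi : 0 < c ->
  is_derive xi (1 : R) (fun xi => \int[mu]_x gauss_phase p c a xi x) 0.
Proof.
(* One majorant must serve a whole neighbourhood of [xi]; on []-M, M[] each frequency factor is
   bounded by its value at [M]. *)
move=> c0; pose M := `|xi| + 1.
have cn0 : c != 0 by rewrite gt_eqF.
have c20 : 0 < (2 * c)^-1 by rewrite invr_gt0; lra.
have cA : 0 <= 2 * c * (c^-1 + 1).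
  by rewrite mulr_ge0 ?addr_ge0 ?invr_ge0 ?(ltW c0)//; lra.
pose G x := ((2 * c)^-1 * expR (M ^+ 2 / (4 * c)) * (M + 2 * c * (c^-1 + 1))) *
  expR (- (c / 2 * (x - a) ^+ 2)).
have Ge : partial1of2 (gauss_phase p c a) = gauss_phase' p c a.
  apply/funext => t; apply/funext => y; rewrite partial1of2E.
  by have := is_derive_gauss_phase_freq p (y - a) t cn0 => ?; exact: derive_val.
have xiM : [set` `]- M, M[] xi.
  by rewrite /= in_itv/= -ltr_norml /M ltrDl.
have iG : mu.-integrable setT (EFin \o G).
  by apply: integrableR_Zl; apply: integrable_gauss; lra.
have fi x : [set` `]- M, M[] x -> mu.-integrable setT (EFin \o gauss_phase p c a x).
  by move=> _; exact: integrable_gauss_phase.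
have der x y : [set` `]- M, M[] x -> setT y ->
    derivable (gauss_phase p c a ^~ y) x 1.
  by move=> _ _; have [] := is_derive_gauss_phase_freq p (y - a) x cn0.
have G0 y : 0 <= G y.
  by rewrite !mulr_ge0 ?expR_ge0 ?(ltW c20)// addr_ge0// addr_ge0.
have GP x y : [set` `]- M, M[] x -> setT y ->
    `|partial1of2 (gauss_phase p c a) x y| <= G y.
  rewrite /= in_itv/= -ltr_norml => xM _; rewrite Ge /gauss_phase' /G.
  rewrite -[X in `|X|]mulrA normrM ger0_norm; last first.
    by rewrite mulr_ge0 ?expR_ge0// ltW.
  rewrite -!(mulrA (2 * c)^-1) ler_pM2l//.
  rewrite -(mulrA (expR (M ^+ 2 / (4 * c)))) ler_pM ?expR_ge0//.
    rewrite ler_expR ler_wpM2r ?invr_ge0 ?mulr_ge0 ?(ltW c0)//.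
    by rewrite -(real_normK (num_real x)) ler_sqr ?nnegrE// ltW// (le_lt_trans _ xM).
  apply: le_trans (norm_gauss_phase_le _ _ _ c0) _.
  by rewrite ler_wpM2r ?expR_ge0// lerD2r ltW.
have D := derivable_under_integral measurableT xiM fi der G0 iG GP.
have E := differentiation_under_integral measurableT xiM fi der G0 iG GP.
apply: DeriveDef; first exact: D.
rewrite -derive1E [LHS]E Ge /gauss_phase'.
exact: sin_gauss_derive_integral0.
Qed.

(* [exp(xi^2/4c) \int cos(p + xi(x-a)) exp(-c(x-a)^2) dx] does not depend on [xi]:
   its integrand has the same xi-derivative as the x-derivative of a Schwartz function. *)
Lemma Rintegral_cos_gauss p c xi a : 0 < c ->
  \int[mu]_x (cos (p + xi * (x - a)) * expR (- (c * (x - a) ^+ 2))) =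
  Num.sqrt (pi / c) * expR (- (xi ^+ 2 / (4 * c))) * cos p.
Proof.
move=> c0.
have H : \int[mu]_x gauss_phase p c a xi x = \int[mu]_x gauss_phase p c a 0 x.
  apply: (is_derive_0_is_cst (f := fun xi => \int[mu]_x gauss_phase p c a xi x)).
  by move=> x; exact: is_derive_integral_gauss_phase.
have g0 : \int[mu]_x gauss_phase p c a 0 x = cos p * Num.sqrt (pi / c).
  rewrite /gauss_phase.
  under eq_Rintegral do rewrite expr0n/= mul0r expR0 mul1r mul0r addr0.
  rewrite RintegralZl//; last exact: integrable_gauss.
  by congr (_ * _); rewrite /Rintegral integral_gauss_fun.
move: H; rewrite g0 /gauss_phase.
under eq_Rintegral do rewrite -mulrA.
rewrite RintegralZl//; last exact: integrable_cos_gauss.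
move=> /(congr1 (fun y => expR (- (xi ^+ 2 / (4 * c))) * y)).
rewrite mulrA -expRD addNr expR0 mul1r => ->.
by ring.
Qed.

End GaussFourier.

(** * Gamma integrals and Gaussian mixtures *)

Section ExpIntegrals.
Variable R : realType.
Notation mu := (@lebesgue_measure R).
Implicit Types (f g h : R -> R) (a b c l x y z u nu : R).

Lemma integrable_expR_Nabs b : 0 < b ->
  mu.-integrable setT (EFin \o (fun u => expR (- (b * `|u|)))).
Proof.
move=> b0.
have cf : continuous (fun u : R => expR (- (b * `|u|))).
  move=> u; apply: continuous_comp; last exact: continuous_expR.
  apply: (@continuousN _ R^o); apply: (@continuousM _ R^o); first exact: cst_continuous.
  exact: norm_continuous.
apply: integrableR_ge0P.
- exact: continuous_measurable_fun.
- by move=> x; exact: expR_ge0.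
rewrite ge0_symfun_integralT; [|by move=> x; exact: expR_ge0|exact: cf|
  by move=> x /=; rewrite normrN].
apply: lte_mul_pinfty => //.
rewrite (_ : [set x | _] = `[0, +oo[%classic); last first.
  by apply/seteqP; split => x/=; rewrite in_itv/= andbT.
apply: (@le_lt_trans _ _ (\int[mu]_x (b^-1 * exponential_pdf b x)%:E)%E).
  rewrite integral_mkcond; apply: ge0_le_integral => //.
  - by move=> x _; rewrite patchE; case: ifP => // _; rewrite lee_fin expR_ge0.
  - apply/(measurable_restrictT _ _).1 => //; apply/measurable_EFinP.
    by apply: measurable_funTS; exact: continuous_measurable_fun.
  - apply/measurable_EFinP; apply: measurable_funM => //.
    exact: measurable_exponential_pdf.
  - move=> x _; rewrite patchE; case: ifPn => [|_].
      rewrite inE/= in_itv/= andbT => x0; rewrite exponential_pdfE// ger0_norm//.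
      by rewrite lee_fin mulrA mulVf ?gt_eqF// mul1r mulNr.
    by rewrite lee_fin mulr_ge0 ?invr_ge0 ?(ltW b0)// exponential_pdf_ge0// ltW.
under eq_integral do rewrite EFinM.
rewrite ge0_integralZl//; first by rewrite integral_exponential_pdf// mule1 ltry.
- by apply/measurable_EFinP; exact: measurable_exponential_pdf.
- by move=> x _; rewrite lee_fin exponential_pdf_ge0// ltW.
- by rewrite lee_fin invr_ge0 ltW.
Qed.

Lemma measurable_expR_comp f : measurable_fun [set: R] f ->
  measurable_fun [set: R] (fun x => expR (f x)).
Proof. by move=> mf; apply: measurableT_comp. Qed.

Lemma measurable_gamma_fun b l :
  measurable_fun [set: R] (fun u => expR (b * u - l * expR u)).
Proof.
apply: measurable_expR_comp; apply: measurable_funB; first exact: measurable_funM.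
by apply: measurable_funM => //; exact: measurable_expR.
Qed.

Lemma integrable_gamma_fun b l : 0 < b -> 0 < l ->
  mu.-integrable setT (EFin \o (fun u => expR (b * u - l * expR u))).
Proof.
move=> b0 l0.
(* For [u < 0] the factor [exp (b u)] already decays. For [u >= 0], [exp u >= 1 + u^2 / 2], and
   completing the square in [2 b u - l u^2 / 2] produces the constant [2 b^2 / l]. *)
apply: (le_integrableR (g := fun u => expR (2 * b ^+ 2 / l) * expR (- (b * `|u|)))).
- exact: measurable_gamma_fun.
- move=> u; rewrite ger0_norm ?expR_ge0// -expRD ler_expR.
  have C0 : 0 <= 2 * b ^+ 2 / l by rewrite divr_ge0 ?mulr_ge0 ?sqr_ge0// ltW.
  have [u0|u0] := leP 0 u.
    rewrite ger0_norm//.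
    have := expR_ge1Dxn 1 u0; rewrite (_ : 2`!%:R = 2 :> R)// => e2.
    have H : l * (1 + u ^+ 2 / 2) <= l * expR u by rewrite ler_pM2l.
    have : 0 <= l / 2 * (u - 2 * b / l) ^+ 2 by rewrite mulr_ge0 ?sqr_ge0//; lra.
    have -> : l / 2 * (u - 2 * b / l) ^+ 2 = l * (u ^+ 2 / 2) - 2 * b * u + 2 * b ^+ 2 / l.
      by field; rewrite gt_eqF.
    move: H; rewrite mulrDr mulr1; lra.
  rewrite ltr0_norm// mulrN opprK.
  have : 0 <= l * expR u by rewrite mulr_ge0 ?expR_ge0// ltW.
  lra.
- by apply: integrableR_Zl; exact: integrable_expR_Nabs.
Qed.

(** Euler's Gamma integral at [b] in the variable [t = exp u]. *)
Definition gammaE b := \int[mu]_u expR (b * u - expR u).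

Let gamma_fun1 b : (fun u => expR (b * u - expR u)) =
  (fun u => expR (b * u - 1 * expR u)).
Proof. by apply/funext => u; rewrite mul1r. Qed.

Lemma measurable_gamma_fun1 b :
  measurable_fun [set: R] (fun u => expR (b * u - expR u)).
Proof. by rewrite gamma_fun1; exact: measurable_gamma_fun. Qed.

Lemma integrable_gamma_fun1 b : 0 < b ->
  mu.-integrable setT (EFin \o (fun u => expR (b * u - expR u))).
Proof. by move=> b0; rewrite gamma_fun1; exact: integrable_gamma_fun. Qed.

Lemma gammaE_gt0 b : 0 < b -> 0 < gammaE b.
Proof.
move=> b0; apply: Rintegral_gt0 (integrable_gamma_fun1 b0) => //.
- exact: lebesgue_measureT_gt0.
- exact: measurable_gamma_fun1.
- by move=> x _; exact: expR_gt0.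
Qed.

(** With [l = 1 + |xi|^2] this writes the Bessel weight [(1 + |xi|^2)^-b] as a mixture of Gaussians
    in [xi]. Translating [u] by [ln l] absorbs [l]. *)
Lemma Rintegral_gamma_scale b l : 0 < l -> 0 < b ->
  \int[mu]_u expR (b * u - l * expR u) = l `^ (- b) * gammaE b.
Proof.
move=> l0 b0; rewrite /gammaE.
rewrite -(@Rintegral_shift _ (fun u => expR (b * u - expR u)) (ln l)); last first.
  exact: measurable_gamma_fun1.
rewrite -RintegralZl//; last first.
  exact: (integrableR_shift _ (integrable_gamma_fun1 b0)).
apply: eq_Rintegral => u _.
rewrite /powR gt_eqF// -expRD; congr expR.
by rewrite expRD lnK ?posrE// mulNr; ring.
Qed.

(* Up to a constant factor, [bpot nu z] is [z^nu K_nu(z)]: the Gaussian mixture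
   representation of the Bessel potential, with mixing variable [t = exp u]. *)
Definition bpot_fun nu z u := expR (nu * u - expR u - z ^+ 2 / 4 * expR (- u)).
Definition bpot nu z := \int[mu]_u bpot_fun nu z u.

Lemma measurable_bpot_fun nu z : measurable_fun [set: R] (bpot_fun nu z).
Proof.
apply: measurable_expR_comp; apply: measurable_funB.
  by apply: measurable_funB; [exact: measurable_funM|exact: measurable_expR].
by apply: measurable_funM => //; apply: measurable_expR_comp.
Qed.

Lemma bpot_fun_le nu z u : bpot_fun nu z u <= expR (nu * u - expR u).
Proof.
by rewrite ler_expR gerBl mulr_ge0 ?expR_ge0// divr_ge0 ?sqr_ge0.
Qed.

Lemma integrable_bpot_fun nu z : 0 < nu ->
  mu.-integrable setT (EFin \o bpot_fun nu z).
Proof.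
move=> nu0; apply: le_integrableR (integrable_gamma_fun1 nu0).
  exact: measurable_bpot_fun.
by move=> u; rewrite ger0_norm ?expR_ge0// bpot_fun_le.
Qed.

Lemma bpot_ge0 nu z : 0 <= bpot nu z.
Proof. by apply: Rintegral_ge0 => u _; exact: expR_ge0. Qed.

Lemma bpot_le_gammaE nu z : 0 < nu -> bpot nu z <= gammaE nu.
Proof.
move=> nu0; apply: le_Rintegral => //; first exact: integrable_bpot_fun.
- exact: integrable_gamma_fun1.
- by move=> u _; exact: bpot_fun_le.
Qed.

(** Of the term [exp u], one half keeps the integral finite, whence the scale [l = 1/2], and the
    other half is traded against [z^2 exp (- u) / 4] for the decay in [z]. *)
Lemma bpot_le_expR nu z : 0 < nu ->
  bpot nu z <= 2^-1 `^ (- nu) * gammaE nu * expR (- (z / 2)).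
Proof.
move=> nu0; have h0 : 0 < 2^-1 :> R by lra.
rewrite -Rintegral_gamma_scale// -RintegralZr//; last exact: integrable_gamma_fun.
apply: le_Rintegral => //; first exact: integrable_bpot_fun.
  have := integrableR_Zl (expR (- (z / 2))) (integrable_gamma_fun nu0 h0).
  by under [X in EFin \o X]eq_fun do rewrite mulrC.
move=> u _; rewrite -expRD ler_expR.
(* AM-GM: [exp u / 2 + z^2 exp(-u) / 4 >= z / 2]. *)
have e0 : 0 < expR u by exact: expR_gt0.
have ee : expR u * expR (- u) = 1 by exact: expRxMexpNx_1.
have -> : z ^+ 2 / 4 * expR (- u) = (z * expR (- u)) ^+ 2 / 4 * expR u.
  rewrite -[LHS]mulr1 -ee; ring.
have -> : z / 2 = (z * expR (- u)) / 2 * expR u.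
  by rewrite -[LHS]mulr1 -ee; ring.
move: (z * expR (- u)) => y.
have : 0 <= expR u * ((y - 1) ^+ 2 / 4 + 4^-1).
  by rewrite mulr_ge0 ?(ltW e0)// addr_ge0 ?divr_ge0 ?sqr_ge0 ?invr_ge0.
by nra.
Qed.

(** The Gamma integrand dominates uniformly in [z]. Continuity identifies the kernel at 0, defined
    there as a limit, and gives measurability of the translates. *)
Lemma continuous_bpot nu : 0 < nu -> continuous (bpot nu).
Proof.
move=> nu0 z.
have H := @continuity_under_integral R _ _ mu (bpot_fun nu) setT measurableT
  (z - 1) (z + 1) (fun x _ => integrable_bpot_fun x nu0) _
  (fun u => expR (nu * u - expR u)) (integrable_gamma_fun1 nu0) _.
apply: H; last by rewrite inE/= in_itv/= ltrBlDr ltrDl ltr01.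
- apply: aeW => u _ x _; apply: continuous_comp; last exact: continuous_expR.
  apply: (@continuousB _ R^o); first exact: cst_continuous.
  apply: (@continuousM _ R^o); last exact: cst_continuous.
  apply: (@continuousM _ R^o); last exact: cst_continuous.
  exact: exprn_continuous.
- move=> x _; apply: aeW => u _.
  by rewrite ger0_norm ?expR_ge0// bpot_fun_le.
Qed.

End ExpIntegrals.

(** * Bessel kernel *)

Section Kernel.
Variable R : realType.
Notation mu := (@lebesgue_measure R).
Implicit Types (f g h : R -> R) (a b c l x y z u nu : R).

Lemma derive1_ln x : 0 < x -> derive1 (@ln R) x = x^-1.
Proof. by move=> x0; rewrite derive1E; have := is_derive1_ln x0 => ?; exact: derive_val. Qed.

Lemma cvg_ln_pinfty : @ln R x @[x --> +oo] --> +oo.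
Proof.
apply/cvgryPge => A; near=> x.
have Ax : expR A <= x by near: x; apply: nbhs_pinfty_ge; exact: num_real.
by rewrite -[A]expRK ler_ln ?posrE ?(lt_le_trans _ Ax) ?expR_gt0.
Unshelve. all: end_near. Qed.

Lemma measurable_Gamma_fun b (D : set R) : measurable D ->
  measurable_fun D (fun t => t `^ (b - 1) * expR (- t)).
Proof.
move=> mD; apply: measurable_funTS; apply: measurable_funM.
  exact: measurable_powR.
by apply: measurableT_comp.
Qed.

(** The substitution [t = exp u] is made away from 0, where [ln] is regular; enlarging the half-line
    to the whole line makes the bound uniform in [a]. *)
Lemma Gamma_itvcy_le b (a : R) : 0 < b -> 0 < a ->
  (\int[mu]_(t in `[a, +oo[) (t `^ (b - 1) * expR (- t))%:E <=
   (gammaE b)%:E)%E.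
Proof.
move=> b0 a0.
have cG : continuous (fun u : R => expR (b * u - expR u)).
  move=> u; apply: continuous_comp; last exact: continuous_expR.
  apply: (@continuousB _ R^o); last exact: continuous_expR.
  by apply: (@continuousM _ R^o); [exact: cst_continuous|exact: id].
have near_inv x : 0 < x -> \forall y \near x, y^-1 = derive1 (@ln R) y.
  by move=> x0; near=> y; rewrite derive1_ln//; near: y; exact: lt_nbhsr.
have cinv x : 0 < x -> derive1 (@ln R) y @[y --> x] --> x^-1.
  move=> x0; have /near_eq_cvg/cvg_trans := near_inv x x0; apply.
  by apply: inv_continuous; rewrite gt_eqF.
have -> : (\int[mu]_(t in `[a, +oo[) (t `^ (b - 1) * expR (- t))%:E =
   \int[mu]_(t in `[ln a, +oo[) (expR (b * t - expR t))%:E)%E.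
  rewrite (@increasing_ge0_integration_by_substitutiony _ (@ln R) _ a); last first.
  - by move=> x _; exact: expR_ge0.
  - exact: continuous_subspaceT.
  - exact: cvg_ln_pinfty.
  - split; last first.
      by apply: cvg_at_right_filter; exact: continuous_ln.
    move=> x; rewrite in_itv/= andbT => ax.
    by have [] := is_derive1_ln (lt_trans a0 ax).
  - apply/cvg_ex; exists 0.
    have /near_eq_cvg/cvg_trans : \forall y \near +oo, y^-1 = derive1 (@ln R) y.
      by near=> y; rewrite derive1_ln//; near: y; exact: nbhs_pinfty_gt.
    apply; apply/gtr0_cvgV0; last exact: cvg_id.
    by near=> y; near: y; exact: nbhs_pinfty_gt.
  - by apply/cvg_ex; exists a^-1; apply: cvg_at_right_filter; exact: cinv.
  - move=> x; rewrite in_itv/= andbT => ax.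
    have x0 := lt_trans a0 ax.
    by rewrite /prop_for /continuous_at derive1_ln//; exact: cinv.
  - move=> x y; rewrite !in_itv/= !andbT => ax ay xy.
    by rewrite ltr_ln// posrE (lt_le_trans a0).
  apply: eq_integral => t; rewrite inE/= in_itv/= andbT => ta.
  have t0 := lt_le_trans a0 ta.
  rewrite !fctE derive1_ln// lnK ?posrE// expRD /powR gt_eqF// mulrBl mul1r.
  rewrite expRD [in RHS]mulrAC; congr ((_ * _ * _)%:E).
  by rewrite expRN lnK.
rewrite /gammaE /Rintegral fineK; last first.
  exact/integrable_fin_num/integrable_gamma_fun1.
apply: ge0_subset_integral => //.
by apply/measurable_EFinP; exact: measurable_gamma_fun1.
Unshelve. all: end_near. Qed.

(** [Gamma] is [fine] of this integral and would be 0 if the integral were infinite. Finiteness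
    follows by monotone convergence along [[1 / (k + 1), +oo[] from the uniform bound above. *)
Lemma integrable_Gamma_fun b : 0 < b ->
  mu.-integrable `]0, +oo[ (EFin \o (fun t => t `^ (b - 1) * expR (- t))).
Proof.
move=> b0; apply/integrableP; split.
  by apply/measurable_EFinP; exact: measurable_Gamma_fun.
under eq_integral do rewrite /= ger0_norm ?mulr_ge0 ?powR_ge0 ?expR_ge0//.
pose F (k : nat) := `[k.+1%:R^-1, +oo[%classic : set R.
have F0 : `]0, +oo[%classic = \bigcup_k F k.
  apply/seteqP; split => x /=; rewrite /F /= in_itv/= andbT.
    move=> x0; exists (Num.bound x^-1) => //=; rewrite in_itv/= andbT.
    rewrite -[leRHS]invrK lef_pV2 ?posrE ?invr_gt0//.
    have x1 : 0 <= x^-1 by rewrite invr_ge0 ltW.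
    by rewrite (le_trans (ltW (archi_boundP x1))) ?ler_nat.
  by move=> [k _ /=]; rewrite in_itv/= andbT; apply: lt_le_trans; rewrite invr_gt0.
have H : (\int[mu]_(x in F i) (x `^ (b - 1) * expR (- x))%:E)%E @[i --> \oo] -->
    (\int[mu]_(x in \bigcup_i F i) (x `^ (b - 1) * expR (- x))%:E)%E.
  apply: ge0_nondecreasing_set_cvg_integral.
  - move=> m k mk; apply/subsetPset => x; rewrite /F /= !in_itv/= !andbT.
    by apply: le_trans; rewrite lef_pV2 ?posrE// ler_nat.
  - by move=> i; exact: measurable_itv.
  - by move=> i; apply/measurable_EFinP; apply: measurable_Gamma_fun; exact: measurable_itv.
  - by move=> i x _; rewrite lee_fin; apply: mulr_ge0; rewrite ?powR_ge0 ?expR_ge0.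
rewrite F0 -(cvg_lim _ H)//.
apply: (@le_lt_trans _ _ (gammaE b)%:E); last exact: ltry.
apply: lime_le; first by apply/cvg_ex; eexists; exact: H.
by apply: nearW => k; apply: Gamma_itvcy_le.
Qed.

Lemma Gamma_gt0 b : 0 < b -> 0 < Gamma b.
Proof.
move=> b0; apply: Rintegral_gt0 (integrable_Gamma_fun b0) => //.
- by rewrite lebesgue_measure_itv/= ltry/= ltry.
- exact: measurable_Gamma_fun.
- by move=> t; rewrite /= in_itv/= andbT => t0; rewrite mulr_gt0 ?powR_gt0 ?expR_gt0.
Qed.


Lemma continuous_coshR : continuous (@coshR R).
Proof.
move=> x.
apply: (@continuousM _ R^o (fun t : R => expR t + expR (- t)) (fun=> 2^-1));
  last exact: cst_continuous.
apply: (@continuousD _ R^o); first exact: continuous_expR.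
by apply: continuous_comp; [exact: (@continuousN _ R^o)|exact: continuous_expR].
Qed.

Lemma measurable_coshR : measurable_fun [set: R] (@coshR R).
Proof. by apply: continuous_measurable_fun; exact: continuous_coshR. Qed.

Lemma coshRN x : coshR (- x) = coshR x.
Proof. by rewrite /coshR opprK addrC. Qed.

Lemma coshR_ge0 x : 0 <= coshR x.
Proof. by rewrite divr_ge0 ?addr_ge0 ?expR_ge0. Qed.

(** The translation [u = t + ln (z / 2)] turns [exp u + z^2 exp (- u) / 4] into [z cosh t].
    Averaging the integrand over [t] and [- t] produces [cosh (nu t)] and an even function, so the
    half-line integral defining [besselK] is half of the full one. *)
Lemma besselK_bpot nu z : 0 < nu -> 0 < z ->
  besselK nu z * z `^ nu = 2 `^ nu / 2 * bpot nu z.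
Proof.
move=> nu0 z0.
pose F t := expR (nu * t - z * coshR t).
have F0 t : (0 <= (F t)%:E)%E by rewrite lee_fin expR_ge0.
have mF : measurable_fun [set: R] F.
  apply: measurable_expR_comp; apply: measurable_funB; first exact: measurable_funM.
  by apply: measurable_funM => //; exact: measurable_coshR.
pose l := ln (z / 2).
have z20 : 0 < z / 2 by rewrite divr_gt0.
have FE : (fun t => bpot_fun nu z (t + l)) = (fun t => (z / 2) `^ nu * F t).
  apply/funext => t; rewrite /bpot_fun /F /powR gt_eqF// -expRD; congr expR.
  rewrite opprD !expRD [expR (- l)]expRN /l lnK ?posrE// /coshR.
  by field; rewrite gt_eqF.
have iF : mu.-integrable setT (EFin \o F).
  have -> : F = (fun t => ((z / 2) `^ nu)^-1 * bpot_fun nu z (t + l)).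
    apply/funext => t; rewrite (congr1 (@^~ t) FE).
    by rewrite mulrA mulVf ?mul1r// gt_eqF// powR_gt0.
  by apply: integrableR_Zl; exact: (integrableR_shift l (integrable_bpot_fun z nu0)).
have bE : bpot nu z = (z / 2) `^ nu * \int[mu]_t F t.
  rewrite -RintegralZl// -FE /bpot -(@Rintegral_shift _ _ l)//.
  exact: measurable_bpot_fun.
pose S t := expR (- (z * coshR t)) * coshR (nu * t).
have SE : (fun t => (S t)%:E) = (fun t => ((2^-1)%:E * ((F t)%:E + (F (- t))%:E))%E).
  apply/funext => t; rewrite -EFinD -EFinM /S /F coshRN.
  rewrite !expRD -mulrDl mulrN [in RHS]mulrA mulrC; congr ((_ * _)%:E).
  by rewrite /coshR mulrC.
have S0 t : 0 <= S t by rewrite mulr_ge0 ?expR_ge0 ?coshR_ge0.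
have cS : continuous S.
  move=> t; apply: (@continuousM _ R^o (fun t : R => expR (- (z * coshR t)))
    (fun t => coshR (nu * t))).
    apply: continuous_comp; last exact: continuous_expR.
    apply: (@continuousN _ R^o); apply: (@continuousM _ R^o); first exact: cst_continuous.
    exact: continuous_coshR.
  apply: continuous_comp; last exact: continuous_coshR.
  by apply: (@continuousM _ R^o); [exact: cst_continuous|exact: id].
have : (\int[mu]_t (S t)%:E = \int[mu]_t (F t)%:E)%E.
  have mE : measurable_fun [set: R] (EFin \o F) by exact/measurable_EFinP.
  have mEN : measurable_fun [set: R] (fun t => (F (- t))%:E).
    exact: (measurableT_comp mE).
  rewrite SE ge0_integralZl//; last 2 first.
  - exact: emeasurable_funD.
  - by move=> t _; rewrite adde_ge0.
  rewrite ge0_integralD// (ge0_integral_opp mE)//.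
  rewrite -[X in (X + _)%E]mul1e -[X in (_ + X)%E]mul1e -ge0_muleDl//.
  by rewrite muleA -EFinD -EFinM (_ : 2^-1 * (1 + 1) = 1) ?mul1e//; field.
rewrite (ge0_symfun_integralT S0 cS); last first.
  by move=> t; rewrite /S /= coshRN mulrN coshRN.
rewrite (_ : [set x | _] = `[0, +oo[%classic); last first.
  by apply/seteqP; split => x/=; rewrite in_itv/= andbT.
rewrite -[RHS]fineK; last exact: integrable_fin_num.
rewrite bE /besselK /Rintegral.
move: (fine (\int[_]_ _ (F _)%:E)%E) => r.
case: (\int[_]_(_ in _) _)%E => [s||] /=; last 2 first.
- by rewrite gt0_muley// lte_fin.
- by rewrite gt0_muleNy// lte_fin.
move=> [] <-.
have -> : z `^ nu = (z / 2) `^ nu * 2 `^ nu.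
  by rewrite -powRM ?(ltW z20)// divfK.
by field.
Qed.


(** The normalisation of [Gpos] times the factor of [besselK_bpot] at [nu = al - n/2]. *)
Definition Gcst (n : nat) (al : R) : R :=
  (2 `^ (al - 1 + n%:R / 2) * pi `^ (n%:R / 2) * Gamma al)^-1 *
  (2 `^ (al - n%:R / 2) / 2).

Lemma Gcst_gt0 n al : 0 < al -> 0 < Gcst n al.
Proof.
move=> al0; apply: mulr_gt0; last by rewrite divr_gt0 ?powR_gt0.
by rewrite invr_gt0 !mulr_gt0 ?powR_gt0 ?pi_gt0// Gamma_gt0.
Qed.

Lemma GkerE n al z : n%:R / 2 < al -> 0 <= z ->
  Gker n al z = Gcst n al * bpot (al - n%:R / 2) z.
Proof.
move=> nal; have nu0 : 0 < al - n%:R / 2 by rewrite subr_gt0.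
have GE y : 0 < y -> Gpos n al y = Gcst n al * bpot (al - n%:R / 2) y.
  by move=> y0; rewrite /Gpos -mulrA besselK_bpot// mulrA.
rewrite le_eqVlt => /predU1P[<-|z0]; last by rewrite /Gker z0 GE.
rewrite /Gker ltxx; apply/cvg_lim => //.
have : Gcst n al * bpot (al - n%:R / 2) y @[y --> 0^'+] -->
       Gcst n al * bpot (al - n%:R / 2) 0.
  apply: cvg_at_right_filter; apply: cvgMr; exact: continuous_bpot.
apply: cvg_trans; apply: near_eq_cvg; near=> y.
by rewrite GE//; near: y; exact: nbhs_right_gt.
Unshelve. all: end_near. Qed.

End Kernel.

(** * Fubini for one-dimensional mixtures of modulated Gaussians *)

Section GaussMixture.
Variable R : realType.
Notation mu := (@lebesgue_measure R).
Implicit Types (W c : R -> R) (x u th xi a : R).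

Let gauss2 W c a (z : R * R) := `|W z.2| * expR (- (c z.2 * (z.1 - a) ^+ 2)).
Let wave2 W c th xi a (z : R * R) :=
  W z.2 * (cos (th + xi * z.1) * expR (- (c z.2 * (z.1 - a) ^+ 2))).

Let measurable_gauss2 c a : measurable_fun [set: R] c ->
  measurable_fun [set: R * R] (fun z => expR (- (c z.2 * (z.1 - a) ^+ 2))).
Proof.
move=> mc; apply: measurableT_comp => //; apply: measurableT_comp => //.
apply: measurable_funM; first exact: (measurableT_comp mc).
by apply: measurable_funX; exact: measurable_funB.
Qed.

(** By Tonelli, integrating in [x] first leaves [|W u| sqrt (pi / c u)]; this is the origin of the
    last integrability hypothesis. *)
Let integrable_gauss2 W c a :
  measurable_fun [set: R] W -> measurable_fun [set: R] c -> (forall u, 0 < c u) ->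
  mu.-integrable setT (EFin \o (fun u => W u * Num.sqrt (pi / c u))) ->
  (mu \x mu)%E.-integrable setT (EFin \o gauss2 W c a).
Proof.
move=> mW mc c0 /integrableP[_ iWs].
have m2 : measurable_fun [set: R * R] (gauss2 W c a).
  apply: measurable_funM; last exact: measurable_gauss2.
  by apply: measurableT_comp => //; exact: (measurableT_comp mW).
apply/integrable21ltyP; first exact/measurable_EFinP.
apply: le_lt_trans iWs.
rewrite le_eqVlt; apply/orP; left; apply/eqP.
apply: eq_integral => u _ /=; rewrite /gauss2/=.
under eq_integral do rewrite /= normrM normr_id (ger0_norm (expR_ge0 _)) EFinM.
rewrite ge0_integralZl//; last by apply/measurable_EFinP; exact: measurable_gauss.
by rewrite integral_gauss_fun// -EFinM normrM (ger0_norm (sqrtr_ge0 _)).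
Qed.

Let integrable_wave2 W c th xi a :
  measurable_fun [set: R] W -> measurable_fun [set: R] c -> (forall u, 0 < c u) ->
  mu.-integrable setT (EFin \o (fun u => W u * Num.sqrt (pi / c u))) ->
  (mu \x mu)%E.-integrable setT (EFin \o wave2 W c th xi a).
Proof.
move=> mW mc c0 iWs; apply: le_integrable (integrable_gauss2 a mW mc c0 iWs) => //.
  apply/measurable_EFinP; apply: measurable_funM; first exact: (measurableT_comp mW).
  apply: measurable_funM; last exact: measurable_gauss2.
  apply: (measurableT_comp (@measurable_cosR R)).
  by apply: measurable_funD => //; exact: measurable_funM.
move=> z _; rewrite /= lee_fin /wave2 /gauss2 !normrM !normr_id ler_wpM2l//.
by rewrite ler_piMl// norm_cos_le1.
Qed.

Let wave1 W c th xi a x u := W u * cos (th + xi * x) * expR (- (c u * (x - a) ^+ 2)).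

Let wave1E W c th xi a x : wave1 W c th xi a x = fun u => wave2 W c th xi a (x, u).
Proof. by apply/funext => u; rewrite /wave1 /wave2/= mulrA. Qed.

Let fubini_wave W c th xi a :
  measurable_fun [set: R] W -> measurable_fun [set: R] c -> (forall u, 0 < c u) ->
  mu.-integrable setT (EFin \o W) ->
  mu.-integrable setT (EFin \o (fun u => W u * Num.sqrt (pi / c u))) ->
  (fun x => (\int[mu]_u wave1 W c th xi a x u)%:E) =
  fubini_F mu (EFin \o wave2 W c th xi a).
Proof.
move=> mW mc c0 iW iWs; apply/funext => x; rewrite /fubini_F wave1E /Rintegral fineK//.
apply: integrable_fin_num => //; apply: le_abs_integrableR iW.
  rewrite -wave1E; apply: measurable_funM; first exact: measurable_funM.
  apply: measurableT_comp => //; apply: measurableT_comp => //.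
  exact: measurable_funM.
move=> u; rewrite /wave2/= normrM ler_piMr// normrM mulr_ile1//.
  exact: norm_cos_le1.
by rewrite ger0_norm ?expR_ge0// expR_le1 oppr_le0 mulr_ge0 ?sqr_ge0 ?ltW.
Qed.

Lemma integrable_wave W c th xi a :
  measurable_fun [set: R] W -> measurable_fun [set: R] c -> (forall u, 0 < c u) ->
  mu.-integrable setT (EFin \o W) ->
  mu.-integrable setT (EFin \o (fun u => W u * Num.sqrt (pi / c u))) ->
  mu.-integrable setT (EFin \o (fun x =>
    \int[mu]_u (W u * cos (th + xi * x) * expR (- (c u * (x - a) ^+ 2))))).
Proof.
move=> mW mc c0 iW iWs.
apply: eq_integrable (integrable_fubini_F (integrable_wave2 th xi a mW mc c0 iWs)) => //.
by move=> x _; rewrite [RHS](congr1 (@^~ x) (fubini_wave th xi a mW mc c0 iW iWs)).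
Qed.

(** After the exchange of integrals, each [u] gives a single Gaussian transform,
    [Rintegral_cos_gauss] with the phase recentred at [a]:
    [th + xi x = (th + xi a) + xi (x - a)]. *)
Lemma integral_wave W c th xi a :
  measurable_fun [set: R] W -> measurable_fun [set: R] c -> (forall u, 0 < c u) ->
  mu.-integrable setT (EFin \o W) ->
  mu.-integrable setT (EFin \o (fun u => W u * Num.sqrt (pi / c u))) ->
  (\int[mu]_x (\int[mu]_u
     (W u * cos (th + xi * x) * expR (- (c u * (x - a) ^+ 2)))%R)%:E)%E =
  (\int[mu]_u (W u * Num.sqrt (pi / c u) * expR (- (xi ^+ 2 / (4 * c u))) *
               cos (th + xi * a)))%:E.
Proof.
move=> mW mc c0 iW iWs.
have i2 := integrable_wave2 th xi a mW mc c0 iWs.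
transitivity (\int[mu]_x fubini_F mu (EFin \o wave2 W c th xi a) x)%E.
  apply: eq_integral => x _.
  exact: (congr1 (@^~ x) (fubini_wave th xi a mW mc c0 iW iWs)).
rewrite (integral12_prod_meas1 i2) -(integral21_prod_meas1 i2).
have iu u : mu.-integrable setT
    (EFin \o (fun x => cos (th + xi * x) * expR (- (c u * (x - a) ^+ 2)))).
  have := integrable_cos_gauss (th + xi * a) xi a (c0 u).
  congr (mu.-integrable _ (EFin \o _)); apply/funext => x.
  by congr (cos _ * _); ring.
have GE : fubini_G mu (EFin \o wave2 W c th xi a) =
  (fun u => (W u * Num.sqrt (pi / c u) * expR (- (xi ^+ 2 / (4 * c u))) *
               cos (th + xi * a))%:E).
  apply/funext => u; rewrite /fubini_G /wave2/=.
  under eq_integral do rewrite EFinM.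
  rewrite integralZl//; last exact: iu.
  rewrite -[X in (_ * X)%E]fineK; last exact: integrable_fin_num (iu u).
  rewrite -EFinM -(mulrA (W u)) -(mulrA (W u)); congr ((_ * _)%:E).
  have := Rintegral_cos_gauss (th + xi * a) xi a (c0 u).
  rewrite /Rintegral => <-; congr fine; apply: eq_integral => x _.
  by congr ((cos _ * _)%:E); ring.
have mG : measurable_fun [set: R] (fun u => W u * Num.sqrt (pi / c u) *
    expR (- (xi ^+ 2 / (4 * c u))) * cos (th + xi * a)).
  apply/measurable_EFinP; rewrite -[X in measurable_fun _ X]GE.
  exact: measurable_fubini_G i2.
transitivity (\int[mu]_u (W u * Num.sqrt (pi / c u) *
    expR (- (xi ^+ 2 / (4 * c u))) * cos (th + xi * a))%:E)%E.
  by apply: eq_integral => u _; exact: (congr1 (@^~ u) GE).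
rewrite /Rintegral fineK//; apply: integrable_fin_num => //.
apply: (le_abs_integrableR mG) iWs => u.
rewrite -mulrA normrM ler_piMr// normrM mulr_ile1//; last exact: norm_cos_le1.
rewrite ger0_norm ?expR_ge0// expR_le1 oppr_le0.
by rewrite divr_ge0 ?sqr_ge0 ?mulr_ge0// ltW.
Qed.

End GaussMixture.

(** * Iterated integrals of Gaussian mixtures *)

Section IteratedIntegral.
Variable R : realType.
Notation mu := (@lebesgue_measure R).
Implicit Types (y u : R).

(** A nonnegative integral is a supremum over simple functions below the integrand, hence monotone
    even where measurability is unknown, as for the inner integrals of [iint]. *)
Lemma ge0_le_integral_nomeas (f g : R -> \bar R) :
  (forall x, 0 <= f x)%E -> (forall x, f x <= g x)%E ->
  (\int[mu]_x f x <= \int[mu]_x g x)%E.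
Proof.
move=> f0 fg.
have g0 x : (0 <= g x)%E by exact: le_trans (f0 x) (fg x).
rewrite !ge0_integralTE//.
apply: ereal_sup_le => _ [h hf <-]; exists h => // x.
exact: le_trans (hf x) (fg x).
Qed.

Lemma iint_ge0 n (f : n.-tuple R -> \bar R) :
  (forall x, 0 <= f x)%E -> (0 <= iint f)%E.
Proof.
elim: n f => [|n IH] f f0 /=; first exact: f0.
by apply: integral_ge0 => x _; apply: IH => t; exact: f0.
Qed.

Lemma le_iint n (f g : n.-tuple R -> \bar R) :
  (forall x, 0 <= f x)%E -> (forall x, f x <= g x)%E -> (iint f <= iint g)%E.
Proof.
elim: n f g => [|n IH] f g f0 fg /=; first exact: fg.
apply: ge0_le_integral_nomeas => x; first by apply: iint_ge0 => t; exact: f0.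
by apply: IH => t; [exact: f0|exact: fg].
Qed.

Lemma eq_iint n (f g : n.-tuple R -> \bar R) : f =1 g -> iint f = iint g.
Proof. by move=> /funext ->. Qed.

Definition tbehead n (x : n.+1.-tuple R) : n.-tuple R := [tuple of behead x].

Lemma tnth_tbehead n (x : n.+1.-tuple R) i :
  tnth (tbehead x) i = tnth x (lift ord0 i).
Proof.
by case/tupleP: x => y t; rewrite tnthS; congr tnth; exact: val_inj.
Qed.

Lemma dotnS n (x y : n.+1.-tuple R) :
  dotn x y = thead x * thead y + dotn (tbehead x) (tbehead y).
Proof.
rewrite /dotn big_ord_recl; congr (_ + _).
by apply: eq_bigr => i _; rewrite !tnth_tbehead.
Qed.

Lemma dotn_cons n (x : n.+1.-tuple R) y (t : n.-tuple R) :
  dotn x [tuple of y :: t] = thead x * y + dotn (tbehead x) t.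
Proof.
by rewrite dotnS theadE; congr (_ + dotn _ _); exact: val_inj.
Qed.

Definition sqdist n (x a : n.-tuple R) := dotn (tsub x a) (tsub x a).

Lemma sqdistE n (x a : n.-tuple R) :
  sqdist x a = \sum_(i < n) (tnth x i - tnth a i) ^+ 2.
Proof. by apply: eq_bigr => i _; rewrite !tnth_mktuple expr2. Qed.

Lemma sqdist_ge0 n (x a : n.-tuple R) : 0 <= sqdist x a.
Proof. by rewrite sqdistE sumr_ge0// => i _; rewrite sqr_ge0. Qed.

Lemma dotnn_ge0 n (x : n.-tuple R) : 0 <= dotn x x.
Proof. by rewrite sumr_ge0// => i _; rewrite -expr2 sqr_ge0. Qed.

Lemma sqdist_cons n y (t : n.-tuple R) (a : n.+1.-tuple R) :
  sqdist [tuple of y :: t] a = (y - thead a) ^+ 2 + sqdist t (tbehead a).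
Proof.
rewrite !sqdistE big_ord_recl; congr (_ + _).
by apply: eq_bigr => i _; rewrite tnth_tbehead tnthS.
Qed.

Lemma measurable_invR (c : R -> R) : measurable_fun [set: R] c ->
  (forall u, 0 < c u) -> measurable_fun [set: R] (fun u => (c u)^-1).
Proof.
move=> mc c0.
rewrite (_ : (fun u => (c u)^-1) = (fun u => c u `^ (- 1))).
  by apply: (measurableT_comp (measurable_powR (- 1))).
by apply/funext => u; rewrite powR_inv1// ltW.
Qed.

Lemma measurable_sqrtR d (T : measurableType d) (c : T -> R) :
  measurable_fun [set: T] c ->
  (forall z, 0 <= c z) -> measurable_fun [set: T] (fun z => Num.sqrt (c z)).
Proof.
move=> mc c0.
rewrite (_ : (fun z => Num.sqrt (c z)) = (fun z => c z `^ 2^-1)).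
  by apply: (measurableT_comp (measurable_powR 2^-1)).
by apply/funext => z; rewrite powR12_sqrt.
Qed.

(** Induction on [n], peeling off the outermost coordinate. The generality makes it close: for a
    fixed outer coordinate its oscillation goes into the phase [th i] and its Gaussian factor into
    the weight [w i]. The finite sum stays inside because [iint] is not known to be additive, and
    [(1 + sqrt (pi / c u)) ^ n] controls every lower power met on the way. *)
Lemma iint_gauss n (I : finType) (c : R -> R) (w : I -> R -> R) (th : I -> R)
    (xi a : I -> n.-tuple R) :
  measurable_fun [set: R] c -> (forall u, 0 < c u) ->
  (forall i, measurable_fun [set: R] (w i)) ->
  (forall i, mu.-integrable setT
     (EFin \o (fun u => w i u * (1 + Num.sqrt (pi / c u)) ^+ n))) ->
  iint (fun x => (\sum_i \int[mu]_u (w i u * cos (th i + dotn (xi i) x) *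
                              expR (- (c u * sqdist x (a i)))))%:E) =
  (\sum_i \int[mu]_u (w i u * Num.sqrt (pi / c u) ^+ n *
                      expR (- (dotn (xi i) (xi i) / (4 * c u))) *
                      cos (th i + dotn (xi i) (a i))))%:E.
Proof.
move=> mc c0.
have ms : measurable_fun [set: R] (fun u => Num.sqrt (pi / c u)).
  apply: measurable_sqrtR; last by move=> u; rewrite divr_ge0 ?pi_ge0// ltW.
  by apply: measurable_funM => //; exact: measurable_invR.
have s0 u : 0 <= Num.sqrt (pi / c u) by exact: sqrtr_ge0.
elim: n w th xi a => [|n IH] w th xi a mw iw.
  rewrite /=; congr EFin; apply: eq_bigr => i _; apply: eq_Rintegral => u _.
  rewrite expr0 mulr1 /sqdist /dotn !big_ord0 mul0r mulr0 oppr0 expR0 !addr0.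
  by rewrite !mulr1.
have iw' i (W : R -> R) : measurable_fun [set: R] W ->
    (forall u, `|W u| <= `|w i u| * (1 + Num.sqrt (pi / c u)) ^+ n.+1) ->
    mu.-integrable setT (EFin \o W).
  move=> mW Ww; apply: (le_abs_integrableR mW) (iw i) => u.
  by rewrite normrM [X in _ * X]ger0_norm// exprn_ge0// addr_ge0.
(* The weight left for the outer coordinate once the inner [n] coordinates have been integrated. *)
pose W i u := w i u * Num.sqrt (pi / c u) ^+ n *
  expR (- (dotn (tbehead (xi i)) (tbehead (xi i)) / (4 * c u))).
have mW i : measurable_fun [set: R] (W i).
  apply: measurable_funM; first by apply: measurable_funM => //; exact: measurable_funX.
  apply: measurable_expR_comp; apply: measurableT_comp => //.
  apply: measurable_funM => //; apply: measurable_invR.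
    exact: measurable_funM.
  by move=> u; rewrite mulr_gt0.
have e1 i u : `|expR (- (dotn (tbehead (xi i)) (tbehead (xi i)) / (4 * c u)))| <= 1.
  rewrite ger0_norm ?expR_ge0// expR_le1 oppr_le0 divr_ge0 ?dotnn_ge0//.
  by rewrite mulr_ge0// ltW.
have Wle i u : `|W i u| <= `|w i u| * Num.sqrt (pi / c u) ^+ n.
  rewrite /W normrM (normrM (w i u)) (ger0_norm (exprn_ge0 n (s0 u))).
  by rewrite ler_piMr// mulr_ge0 ?exprn_ge0.
have iW i : mu.-integrable setT (EFin \o W i).
  apply: (iw' i) => // u; apply: le_trans (Wle i u) _; rewrite ler_wpM2l//.
  rewrite exprS -[leLHS]mul1r ler_pM ?exprn_ge0 ?lerDl//.
  by rewrite lerXn2r ?nnegrE ?addr_ge0// lerDr.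
have iWs i : mu.-integrable setT (EFin \o (fun u => W i u * Num.sqrt (pi / c u))).
  apply: (iw' i) => [|u]; first exact: measurable_funM.
  rewrite normrM (ger0_norm (s0 u)).
  apply: (@le_trans _ _ (`|w i u| * Num.sqrt (pi / c u) ^+ n.+1)).
    by rewrite exprSr mulrA ler_wpM2r.
  by rewrite ler_wpM2l// lerXn2r ?nnegrE ?addr_ge0// lerDr.
transitivity (\int[mu]_x (\sum_i (\int[mu]_u (W i u *
   cos (th i + dotn (tbehead (xi i)) (tbehead (a i)) + thead (xi i) * x) *
   expR (- (c u * (x - thead (a i)) ^+ 2))))%:E))%E.
  rewrite /=; apply: eq_integral => x _.
  pose w' i u := w i u * expR (- (c u * (x - thead (a i)) ^+ 2)).
  have mw' i : measurable_fun [set: R] (w' i).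
    apply: measurable_funM => //; apply: measurable_expR_comp.
    by apply: measurableT_comp => //; exact: measurable_funM.
  rewrite sumEFin.
  transitivity (iint (fun t => (\sum_i \int[mu]_u (w' i u *
      cos ((th i + thead (xi i) * x) + dotn (tbehead (xi i)) t) *
      expR (- (c u * sqdist t (tbehead (a i))))))%:E)).
    apply: eq_iint => t; congr EFin; apply: eq_bigr => i _.
    apply: eq_Rintegral => u _.
    rewrite dotn_cons sqdist_cons mulrDr opprD expRD addrA /w'.
    by rewrite -!mulrA; congr (_ * _); rewrite mulrCA.
  rewrite IH//; last first.
    move=> i; apply: (iw' i).
      apply: measurable_funM => //; apply: measurable_funX.
      exact: measurable_funD.
    move=> u; rewrite /w' !normrM.
    rewrite [X in _ * X]ger0_norm ?exprn_ge0 ?addr_ge0//.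
    rewrite [in leRHS]exprS [leRHS]mulrA ler_wpM2r ?exprn_ge0 ?addr_ge0// ler_wpM2l//.
    rewrite ger0_norm ?expR_ge0// (@le_trans _ _ 1) ?lerDl//.
    by rewrite expR_le1 oppr_le0 mulr_ge0 ?sqr_ge0 ?ltW.
  congr EFin; apply: eq_bigr => i _; apply: eq_Rintegral => u _.
  rewrite /w' /W -[th i + _ + _]addrA [thead _ * _ + _]addrC addrA.
  by ring.
rewrite integral_sum//; last by move=> i; exact: integrable_wave.
rewrite -sumEFin; apply: eq_bigr => i _.
rewrite integral_wave//; congr EFin; apply: eq_Rintegral => u _.
rewrite /W (exprSr (Num.sqrt (pi / c u))) (dotnS (xi i) (xi i)) (dotnS (xi i) (a i)).
rewrite [X in _ = _ * expR X * _](_ : _ =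
   - (dotn (tbehead (xi i)) (tbehead (xi i)) / (4 * c u)) +
   - (thead (xi i) ^+ 2 / (4 * c u))); last by field; rewrite gt_eqF.
rewrite expRD.
have -> : th i + dotn (tbehead (xi i)) (tbehead (a i)) + thead (xi i) * thead (a i) =
  th i + (thead (xi i) * thead (a i) + dotn (tbehead (xi i)) (tbehead (a i))) by ring.
by ring.
Qed.

End IteratedIntegral.

(** * Separated points *)

Section RowSum.
Variable R : realType.

Lemma enorm_ge0 n (x : n.-tuple R) : 0 <= enorm x.
Proof. exact: sqrtr_ge0. Qed.

Lemma enorm_tsub_sqr n (x y : n.-tuple R) : enorm (tsub x y) ^+ 2 = sqdist x y.
Proof. by rewrite sqr_sqrtr ?dotnn_ge0. Qed.

Lemma enorm_sqr n (x : n.-tuple R) : enorm x ^+ 2 = dotn x x.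
Proof. by rewrite sqr_sqrtr ?dotnn_ge0. Qed.

Lemma sqdistC n (x y : n.-tuple R) : sqdist x y = sqdist y x.
Proof. by rewrite !sqdistE; apply: eq_bigr => i _; rewrite -sqrrN opprB. Qed.

Lemma enorm_tsubC n (x y : n.-tuple R) : enorm (tsub x y) = enorm (tsub y x).
Proof. by rewrite /enorm -!/(sqdist _ _) sqdistC. Qed.

Lemma le_coord_enorm n (x y : n.-tuple R) (i : 'I_n) :
  `|tnth x i - tnth y i| <= enorm (tsub x y).
Proof.
rewrite -(ler_pXn2r (n := 2))// ?nnegrE ?enorm_ge0//.
rewrite real_normK ?num_real// enorm_tsub_sqr sqdistE (bigD1 i)//= lerDl.
by rewrite sumr_ge0// => k _; rewrite sqr_ge0.
Qed.

Lemma sum_geometric_le (q : R) M : 0 <= q -> q < 1 ->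
  \sum_(m < M) q ^+ m <= (1 - q)^-1.
Proof.
move=> q0 q1; rewrite -[leRHS]mul1r ler_pdivlMr ?subr_gt0// mulrC.
have := subrX1 q M; rewrite -[q ^+ M - 1]opprB -[q - 1]opprB mulNr => /oppr_inj <-.
by rewrite gerBl exprn_ge0.
Qed.

(* Each cell of a grid of mesh [h <= del / n] contains at most one point, so the sum is
   dominated by a product of [n] geometric series over the cell indices. *)
Lemma separated_sum_expR_le n (xs : nat -> n.-tuple R) (del ka : R) :
  (0 < n)%N -> 0 < del -> 0 < ka ->
  (forall j k : nat, j <> k -> del <= enorm (tsub (xs j) (xs k))) ->
  exists2 S : R, 0 < S & forall (N j : nat),
    \sum_(k < N) expR (- (ka * enorm (tsub (xs j) (xs k)))) <= S.
Proof.
move=> n0 del0 ka0 sep.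
have nR : 0 < n%:R :> R by rewrite ltr0n.
have n1 : 1 <= n%:R :> R by rewrite ler1n.
pose h := del / n%:R; have h0 : 0 < h by rewrite divr_gt0.
pose la := ka / n%:R * h; have la0 : 0 < la by rewrite mulr_gt0 ?divr_gt0.
pose q := expR (- la).
have q0 : 0 <= q by exact: expR_ge0.
have q1 : q < 1 by rewrite expR_lt1 oppr_lt0.
exists ((2 * expR la / (1 - q)) ^+ n).
  by rewrite exprn_gt0// divr_gt0 ?subr_gt0// mulr_gt0 ?expR_gt0.
move=> N j.
pose m (k : nat) (i : 'I_n) : int := Num.floor ((tnth (xs k) i - tnth (xs j) i) / h).
have mP k i : (m k i)%:~R * h <= tnth (xs k) i - tnth (xs j) i < ((m k i)%:~R + 1) * h.
  rewrite -ler_pdivlMr// -ltr_pdivrMr// /m.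
  by have := floor_itv ((tnth (xs k) i - tnth (xs j) i) / h); rewrite intrD.
(* Two points of one cell differ by less than [h] in each coordinate, so their squared distance is
   below [n h^2 = del^2 / n <= del^2]. *)
have m_inj k k' : m k =1 m k' -> k = k'.
  move=> mm; apply/eqP; rewrite -[_ == _]negbK; apply/negP => /eqP/sep.
  rewrite leNgt => /negP; apply.
  rewrite -(ltr_pXn2r (n := 2))// ?nnegrE ?enorm_ge0 ?(ltW del0)// enorm_tsub_sqr sqdistE.
  apply: (@lt_le_trans _ _ (\sum_(i < n) h ^+ 2)).
    apply: ltr_sum; first by apply/hasP; exists (Ordinal n0); rewrite ?mem_index_enum.
    move=> i _; have /andP[l1 r1] := mP k i; have /andP[l2 r2] := mP k' i.
    move: l1 r1 l2 r2; rewrite mm !mulrDl mul1r => l1 r1 l2 r2.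
    rewrite -(real_normK (num_real (_ - _))) ltr_pXn2r// ?nnegrE ?(ltW h0)//.
    rewrite ltr_norml; apply/andP; split; lra.
  rewrite sumr_const card_ord -mulr_natr /h expr_div_n.
  have -> : del ^+ 2 / n%:R ^+ 2 * n%:R = del ^+ 2 / n%:R.
    by field; rewrite gt_eqF.
  by rewrite ler_pdivrMr// ler_peMr ?sqr_ge0.
pose M := \max_(p : 'I_N * 'I_n) absz (m p.1 p.2).
have mM (k : 'I_N) i : (absz (m k i) < M.+1)%N.
  by rewrite ltnS (leq_bigmax (F := fun p : 'I_N * 'I_n => absz (m p.1 p.2)) (k, i)).
(* Encoding a cell by absolute value and sign in each coordinate lands in a finite function type,
   over which a sum of products factors. *)
pose phi (k : 'I_N) : {ffun 'I_n -> 'I_M.+1 * bool} :=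
  [ffun i => (inord (absz (m k i)), m k i < 0)].
have phi_inj : injective phi.
  move=> k k' /ffunP phiE; apply/val_inj/m_inj => i.
  have := phiE i; rewrite !ffunE => -[/(congr1 val)/=].
  rewrite !inordK// => e1 e2.
  by rewrite (intEsign (m k i)) (intEsign (m k' i)) e1 e2.
(* The factor [expR la] pays for cells of negative index [m], whose points may be as close as
   [(|m| - 1) h] in that coordinate. *)
pose F (p : 'I_M.+1 * bool) : R := expR la * q ^+ p.1.
have F0 p : 0 <= F p by rewrite mulr_ge0 ?expR_ge0 ?exprn_ge0.
apply: (@le_trans _ _ (\sum_(k < N) \prod_(i < n) F (phi k i))).
  apply: ler_sum => k _.
  (* Each coordinate receives the share [1 / n] of the distance, which dominates every coordinate
     difference. *)
  have -> : - (ka * enorm (tsub (xs j) (xs k))) =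
      \sum_(i < n) - (ka / n%:R * enorm (tsub (xs j) (xs k))).
    by rewrite sumr_const card_ord -mulr_natr; field; rewrite gt_eqF.
  rewrite expR_sum; apply: ler_prod => i _; rewrite expR_ge0/=.
  rewrite /F ffunE /= inordK// /q -expRM_natl -expRD ler_expR.
  have : (absz (m k i))%:R * h - h <= `|tnth (xs k) i - tnth (xs j) i|.
    have /andP[l1 r1] := mP k i.
    have [m0|m0] := leP 0 (m k i).
      have : ((absz (m k i))%:R : R) = (m k i)%:~R by rewrite -{2}(gez0_abs m0).
      by move=> ->; have := ler_norm (tnth (xs k) i - tnth (xs j) i); lra.
    have : ((absz (m k i))%:R : R) = - (m k i)%:~R.
      by rewrite -[in RHS](opprK (m k i)) -(ltz0_abs m0) intrN opprK.
    move=> ->; have := ler_norm (- (tnth (xs k) i - tnth (xs j) i)).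
    by rewrite normrN; lra.
  have := le_coord_enorm (xs k) (xs j) i; rewrite enorm_tsubC.
  move: (enorm _) (`|_|) => e d de hd.
  have kn0 : 0 < ka / n%:R by rewrite divr_gt0.
  have : ka / n%:R * ((absz (m k i))%:R * h - h) <= ka / n%:R * e.
    by rewrite ler_pM2l// (le_trans hd).
  by rewrite /la; nra.
rewrite -(big_imset (fun f : {ffun 'I_n -> 'I_M.+1 * bool} => \prod_(i < n) F (f i)))/=;
  last by move=> k k' _ _; exact: phi_inj.
apply: (@le_trans _ _ (\sum_(f : {ffun 'I_n -> 'I_M.+1 * bool}) \prod_(i < n) F (f i))).
  rewrite [leRHS](bigID (mem (phi @: 'I_N)))/= lerDl sumr_ge0// => f _.
  by rewrite prodr_ge0.
rewrite -(bigA_distr_bigA (fun _ : 'I_n => F)) prodr_const card_ord.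
rewrite lerXn2r ?nnegrE ?sumr_ge0//.
  by rewrite divr_ge0 ?subr_ge0 ?(ltW q1)// mulr_ge0 ?expR_ge0.
rewrite -(pair_big xpredT xpredT (fun (a : 'I_M.+1) (b : bool) => expR la * q ^+ a))/=.
under eq_bigr do rewrite sumr_const card_bool -mulr_natl mulrA.
rewrite -mulr_sumr ler_wpM2l ?mulr_ge0 ?expR_ge0//.
exact: sum_geometric_le.
Qed.

(** Meant for [t j k = Re (c_j c_k^* )] and [nn j = |c_j|^2]. Symmetry of [g] makes the two halves
    of the mean contribute equally, leaving row sums. *)
Lemma norm_schur_sum_le N (t g : 'I_N -> 'I_N -> R) (nn : 'I_N -> R) (S : R) :
  (forall j k, `|t j k| <= (nn j + nn k) / 2) ->
  (forall j k, 0 <= g j k) -> (forall j k, g j k = g k j) ->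
  (forall j, 0 <= nn j) -> (forall j, \sum_k g j k <= S) ->
  `|\sum_j \sum_k t j k * g j k| <= S * \sum_j nn j.
Proof.
move=> tn g0 gC nn0 gS.
apply: (@le_trans _ _ (\sum_j \sum_k ((nn j + nn k) / 2 * g j k))).
  rewrite (le_trans (ler_norm_sum _ _ _))// ler_sum// => j _.
  rewrite (le_trans (ler_norm_sum _ _ _))// ler_sum// => k _.
  by rewrite normrM (ger0_norm (g0 _ _)) ler_wpM2r.
have -> : \sum_j \sum_k ((nn j + nn k) / 2 * g j k) = \sum_j nn j * \sum_k g j k.
  transitivity (\sum_j \sum_k (nn j / 2 * g j k) + \sum_j \sum_k (nn k / 2 * g j k)).
    rewrite -big_split; apply: eq_bigr => j _; rewrite -big_split.
    by apply: eq_bigr => k _ /=; rewrite !mulrDl.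
  rewrite [X in _ + X]exchange_big -big_split; apply: eq_bigr => j _ /=.
  rewrite mulr_sumr -big_split; apply: eq_bigr => k _ /=.
  by rewrite (gC k j); field.
by rewrite mulr_sumr ler_sum// => j _; rewrite mulrC ler_wpM2r.
Qed.

End RowSum.

(** * Trigonometric sums integrated against Gaussian mixtures *)

Section TrigSums.
Variable R : realType.
Notation mu := (@lebesgue_measure R).

Lemma cosNpihalfD (x : R) : cos (- (pi / 2) + x) = sin x.
Proof. by rewrite cosD cosN sinN cos_pihalf sin_pihalf mul0r mulN1r opprK add0r. Qed.

Lemma exprn_1D_le (s : R) n : 0 <= s -> (1 + s) ^+ n <= 2 ^+ n * (1 + s ^+ n).
Proof.
move=> s0; have [s1|s1] := leP s 1.
  apply: (@le_trans _ _ (2 ^+ n)).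
    by rewrite lerXn2r ?nnegrE ?addr_ge0//; lra.
  by rewrite ler_peMr ?exprn_ge0// lerDl exprn_ge0.
apply: (@le_trans _ _ ((2 * s) ^+ n)).
  by rewrite lerXn2r ?nnegrE ?addr_ge0 ?mulr_ge0//; lra.
by rewrite exprMn ler_wpM2l ?exprn_ge0// lerDr.
Qed.

(** Reduces the integrability hypothesis of [iint_gauss] to the two extreme powers, 0 and [n]. *)
Lemma integrable_exprn_1D (W s : R -> R) n : measurable_fun [set: R] W ->
  measurable_fun [set: R] s -> (forall u, 0 <= s u) ->
  mu.-integrable setT (EFin \o W) ->
  mu.-integrable setT (EFin \o (fun u => W u * s u ^+ n)) ->
  mu.-integrable setT (EFin \o (fun u => W u * (1 + s u) ^+ n)).
Proof.
move=> mW ms s0 iW iWs.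
have := integrableR_Zl (2 ^+ n) (integrableR_D iW iWs).
apply: le_abs_integrableR.
  by apply: measurable_funM => //; apply: measurable_funX; exact: measurable_funD.
move=> u; rewrite -[X in _ * (X + _)]mulr1 -mulrDr mulrCA !normrM.
rewrite ler_wpM2l// -normrM !ger0_norm ?exprn_1D_le//.
- by rewrite mulr_ge0 ?addr_ge0 ?exprn_ge0.
- by rewrite exprn_ge0 ?addr_ge0.
Qed.

(** A sine is a cosine with phase [- pi / 2], so [iint_gauss] applies over the doubled index set
    [I * bool]. *)
Lemma iint_gauss_trig n (I : finType) (c W : R -> R) (p q : I -> R)
    (xi a : I -> n.-tuple R) :
  measurable_fun [set: R] c -> (forall u, 0 < c u) ->
  measurable_fun [set: R] W -> mu.-integrable setT (EFin \o W) ->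
  mu.-integrable setT (EFin \o (fun u => W u * Num.sqrt (pi / c u) ^+ n)) ->
  iint (fun x => (\sum_i (p i * cos (dotn (xi i) x) + q i * sin (dotn (xi i) x)) *
                   \int[mu]_u (W u * expR (- (c u * sqdist x (a i)))))%:E) =
  (\sum_i (p i * cos (dotn (xi i) (a i)) + q i * sin (dotn (xi i) (a i))) *
     \int[mu]_u (W u * Num.sqrt (pi / c u) ^+ n *
                 expR (- (dotn (xi i) (xi i) / (4 * c u)))))%:E.
Proof.
move=> mc c0 mW iW iWs.
pose r (j : I * bool) := if j.2 then p j.1 else q j.1.
pose th (j : I * bool) : R := if j.2 then 0 else - (pi / 2).
have ms : measurable_fun [set: R] (fun u => Num.sqrt (pi / c u)).
  apply: measurable_sqrtR; last by move=> u; rewrite divr_ge0 ?pi_ge0// ltW.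
  by apply: measurable_funM => //; exact: measurable_invR.
have i1 u : 0 <= Num.sqrt (pi / c u) by exact: sqrtr_ge0.
have split2 (y G : I -> R) :
    \sum_(i : I * bool) r i * cos (th i + y i.1) * G i.1 =
    \sum_i (p i * cos (y i) + q i * sin (y i)) * G i.
  rewrite -(pair_big xpredT xpredT
    (fun i b => r (i, b) * cos (th (i, b) + y i) * G i))/=.
  apply: eq_bigr => i _; rewrite big_bool /r /th/= add0r cosNpihalfD.
  by rewrite mulrDl.
have mw (j : I * bool) : measurable_fun [set: R] (fun u => r j * W u).
  exact: measurable_funM.
have iw (j : I * bool) : mu.-integrable setT
    (EFin \o (fun u => r j * W u * (1 + Num.sqrt (pi / c u)) ^+ n)).
  under [X in EFin \o X]eq_fun do rewrite -mulrA.
  by apply: integrableR_Zl; exact: integrable_exprn_1D.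
have H := @iint_gauss R n (I * bool)%type c (fun j u => r j * W u) th
  (fun j => xi j.1) (fun j => a j.1) mc c0 mw iw.
transitivity (iint (fun x => (\sum_(i : I * bool) \int[mu]_u
   (r i * W u * cos (th i + dotn (xi i.1) x) *
    expR (- (c u * sqdist x (a i.1)))))%:E)).
  apply: eq_iint => x; congr EFin.
  rewrite -(split2 (fun i => dotn (xi i) x)
    (fun i => \int[mu]_u (W u * expR (- (c u * sqdist x (a i)))))).
  apply: eq_bigr => i _; rewrite -RintegralZl//.
    by apply: eq_Rintegral => u _; ring.
  apply: (le_abs_integrableR _ _ iW).
    apply: measurable_funM => //; apply: measurable_expR_comp.
    by apply: measurableT_comp => //; exact: measurable_funM.
  move=> u; rewrite normrM ler_piMr// ger0_norm ?expR_ge0//.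
  by rewrite expR_le1 oppr_le0 mulr_ge0 ?sqdist_ge0 ?(ltW (c0 u)).
rewrite H; congr EFin; rewrite -(split2 (fun i => dotn (xi i) (a i))); apply: eq_bigr => i _.
rewrite -RintegralZl//; first by apply: eq_Rintegral => u _; ring.
apply: (le_abs_integrableR _ _ iWs).
  apply: measurable_funM; first by apply: measurable_funM => //; exact: measurable_funX.
  apply: measurable_expR_comp; apply: measurableT_comp => //.
  apply: measurable_funM => //; apply: measurable_invR; first exact: measurable_funM.
  by move=> u; rewrite mulr_gt0.
move=> u; rewrite normrM ler_piMr// ger0_norm ?expR_ge0//.
by rewrite expR_le1 oppr_le0 divr_ge0 ?dotnn_ge0 ?mulr_ge0 ?(ltW (c0 u)).
Qed.

(** The expansion of [|sum_j c_j e^(- i th_j)|^2] for [c_j = a_j + i b_j]; the coefficients are the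
    real and imaginary parts of [c_j c_k^*]. *)
Lemma sqr_cis_sum N (a b th : 'I_N -> R) :
  (\sum_j (a j * cos (th j) + b j * sin (th j))) ^+ 2 +
  (\sum_j (b j * cos (th j) - a j * sin (th j))) ^+ 2 =
  \sum_(p : 'I_N * 'I_N) ((a p.1 * a p.2 + b p.1 * b p.2) * cos (th p.1 - th p.2) +
    (b p.1 * a p.2 - a p.1 * b p.2) * sin (th p.1 - th p.2)).
Proof.
rewrite -(pair_big xpredT xpredT (fun j k => (a j * a k + b j * b k) * cos (th j - th k) +
    (b j * a k - a j * b k) * sin (th j - th k)))/=.
rewrite !expr2 !big_distrl -big_split; apply: eq_bigr => j _ /=.
rewrite !big_distrr -big_split; apply: eq_bigr => k _ /=.
by rewrite cosB sinB; ring.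
Qed.

Lemma dotnC n (x y : n.-tuple R) : dotn x y = dotn y x.
Proof. by apply: eq_bigr => i _; rewrite mulrC. Qed.

Lemma dotn_tsubl n (x y z : n.-tuple R) : dotn (tsub x y) z = dotn x z - dotn y z.
Proof. by rewrite -sumrB; apply: eq_bigr => i _; rewrite tnth_mktuple mulrBl. Qed.

Definition tzero n : n.-tuple R := [tuple 0 | i < n].

Lemma dotn0 n (x : n.-tuple R) : dotn x (tzero n) = 0.
Proof. by rewrite /dotn big1// => i _; rewrite tnth_mktuple mulr0. Qed.

Lemma sqdist0 n (x : n.-tuple R) : sqdist x (tzero n) = dotn x x.
Proof. by rewrite sqdistE; apply: eq_bigr => i _; rewrite tnth_mktuple subr0 expr2. Qed.

(** The Gaussians are centred at the origin, so every phase is evaluated at 0: sine terms vanish and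
    only the real parts of [c_j c_k^*] survive. *)
Lemma iint_sqr_cis_sum n N (c W : R -> R) (a b : 'I_N -> R) (xs : 'I_N -> n.-tuple R) :
  measurable_fun [set: R] c -> (forall u, 0 < c u) ->
  measurable_fun [set: R] W -> mu.-integrable setT (EFin \o W) ->
  mu.-integrable setT (EFin \o (fun u => W u * Num.sqrt (pi / c u) ^+ n)) ->
  iint (fun xi => (((\sum_j (a j * cos (dotn xi (xs j)) + b j * sin (dotn xi (xs j)))) ^+ 2 +
    (\sum_j (b j * cos (dotn xi (xs j)) - a j * sin (dotn xi (xs j)))) ^+ 2) *
    \int[mu]_u (W u * expR (- (c u * dotn xi xi))))%:E) =
  (\sum_j \sum_k (a j * a k + b j * b k) *
     \int[mu]_u (W u * Num.sqrt (pi / c u) ^+ n *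
                 expR (- (sqdist (xs j) (xs k) / (4 * c u)))))%:E.
Proof.
move=> mc c0 mW iW iWs.
have H := @iint_gauss_trig n ('I_N * 'I_N)%type c W
  (fun p => a p.1 * a p.2 + b p.1 * b p.2) (fun p => b p.1 * a p.2 - a p.1 * b p.2)
  (fun p => tsub (xs p.1) (xs p.2)) (fun=> tzero n) mc c0 mW iW iWs.
transitivity (iint (fun x => (\sum_(p : 'I_N * 'I_N)
  ((a p.1 * a p.2 + b p.1 * b p.2) * cos (dotn (tsub (xs p.1) (xs p.2)) x) +
   (b p.1 * a p.2 - a p.1 * b p.2) * sin (dotn (tsub (xs p.1) (xs p.2)) x)) *
    \int[mu]_u (W u * expR (- (c u * sqdist x (tzero n)))))%:E)).
  apply: eq_iint => x; congr EFin; rewrite sqr_cis_sum big_distrl/=.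
  by apply: eq_bigr => p _; rewrite sqdist0 !dotn_tsubl !(dotnC x).
rewrite H; congr EFin.
rewrite -(pair_big xpredT xpredT (fun j k => ((a j * a k + b j * b k) *
   cos (dotn (tsub (xs j) (xs k)) (tzero n)) +
   (b j * a k - a j * b k) * sin (dotn (tsub (xs j) (xs k)) (tzero n))) *
   \int[mu]_u (W u * Num.sqrt (pi / c u) ^+ n *
                 expR (- (dotn (tsub (xs j) (xs k)) (tsub (xs j) (xs k)) / (4 * c u))))))/=.
apply: eq_bigr => j _; apply: eq_bigr => k _.
by rewrite dotn0 cos0 sin0 mulr1 mulr0 addr0.
Qed.

End TrigSums.

(** * Riesz bounds *)

Section Assembly.
Variables (R : realType) (n : nat) (nu al : R).
Hypotheses (nu0 : 0 < nu) (alE : al = nu + n%:R / 2).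
Notation mu := (@lebesgue_measure R).

Let nal : n%:R / 2 < al. Proof. by rewrite alE ltrDr. Qed.
Let al0 : 0 < al.
Proof. by apply: le_lt_trans nal; rewrite divr_ge0 ?ler0n. Qed.

Let mNexp (k : R) : measurable_fun [set: R] (fun u => k * expR (- u)).
Proof. by apply: measurable_funM => //; apply: measurable_expR_comp. Qed.

(** The Gaussian normalisation contributes [exp (n u / 2)], raising the exponent [nu] of the mixture
    to [al = nu + n / 2]; the next lemma provides the opposite shift. *)
Lemma sqrt_pi_expRN u : Num.sqrt (pi / (expR (- u) / 4)) ^+ n =
  Num.sqrt (4 * pi) ^+ n * expR (n%:R / 2 * u) :> R.
Proof.
have -> : pi / (expR (- u) / 4) = 4 * pi * expR (u / 2) ^+ 2 :> R.
  rewrite -expRM_natl expRN invf_div invrK.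
  have -> : 2%:R * (u / 2) = u by field.
  by ring.
rewrite sqrtrM ?mulr_ge0 ?pi_ge0// sqrtr_sqr ger0_norm ?expR_ge0// exprMn.
by rewrite -expRM_natl; congr (_ * expR _); ring.
Qed.

Lemma sqrt_pi_expR u : Num.sqrt (pi / expR u) ^+ n =
  Num.sqrt pi ^+ n * expR (- (n%:R / 2 * u)) :> R.
Proof.
have -> : pi / expR u = pi * expR (- (u / 2)) ^+ 2 :> R.
  rewrite -expRM_natl -expRN; congr (_ * expR _); by field.
rewrite sqrtrM ?pi_ge0// sqrtr_sqr ger0_norm ?expR_ge0// exprMn.
by rewrite -expRM_natl; congr (_ * expR _); ring.
Qed.

(* The Fourier transform of the Gaussian mixture [bpot nu |.|]. *)
Lemma iint_bpot_trig (I : finType) (p q : I -> R) (xi a : I -> n.-tuple R) :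
  iint (fun x => (\sum_i (p i * cos (dotn (xi i) x) + q i * sin (dotn (xi i) x)) *
                   bpot nu (enorm (tsub x (a i))))%:E) =
  (\sum_i (p i * cos (dotn (xi i) (a i)) + q i * sin (dotn (xi i) (a i))) *
     (Num.sqrt (4 * pi) ^+ n * ((1 + dotn (xi i) (xi i)) `^ (- al) * gammaE al)))%:E.
Proof.
pose c (u : R) := expR (- u) / 4.
pose W (u : R) := expR (nu * u - expR u).
have mc : measurable_fun [set: R] c.
  have := mNexp 4^-1; by under eq_fun do rewrite mulrC.
have c0 u : 0 < c u by rewrite divr_gt0 ?expR_gt0.
have sW u : W u * Num.sqrt (pi / c u) ^+ n =
    Num.sqrt (4 * pi) ^+ n * expR (al * u - expR u).
  rewrite /W /c sqrt_pi_expRN mulrCA -expRD alE; congr (_ * expR _); ring.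
have iWs : mu.-integrable setT (EFin \o (fun u => W u * Num.sqrt (pi / c u) ^+ n)).
  under [X in EFin \o X]eq_fun do rewrite sW.
  by apply: integrableR_Zl; exact: integrable_gamma_fun1.
have := iint_gauss_trig p q xi a mc c0 (measurable_gamma_fun1 nu)
  (integrable_gamma_fun1 nu0) iWs.
have -> : (fun x => (\sum_i (p i * cos (dotn (xi i) x) + q i * sin (dotn (xi i) x)) *
     \int[mu]_u (expR (nu * u - expR u) * expR (- (c u * sqdist x (a i)))))%:E) =
  (fun x => (\sum_i (p i * cos (dotn (xi i) x) + q i * sin (dotn (xi i) x)) *
                   bpot nu (enorm (tsub x (a i))))%:E).
  apply/funext => x; congr EFin; apply: eq_bigr => i _; congr (_ * _).
  apply: eq_Rintegral => u _.
  by rewrite -expRD /bpot_fun enorm_tsub_sqr /c; congr expR; field.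
move=> ->; congr EFin; apply: eq_bigr => i _; congr (_ * _).
have d0 : 0 < 1 + dotn (xi i) (xi i) by rewrite ltr_pwDl ?dotnn_ge0.
rewrite -Rintegral_gamma_scale// -RintegralZl//; last exact: integrable_gamma_fun.
apply: eq_Rintegral => u _; rewrite -/(W u) sW -mulrA -expRD; congr (_ * expR _).
rewrite /c expRN; field; rewrite gt_eqF ?expR_gt0//.
Qed.

Variable xs : nat -> n.-tuple R.
Definition Gtrans (j : nat) (x : n.-tuple R) : R[i] :=
  (Gker n al (enorm (tsub x (xs j))))%:C%C.
Local Notation f := Gtrans.

Let fE j x : f j x = (Gcst n al * bpot nu (enorm (tsub x (xs j))))%:C%C.
Proof. by rewrite /Gtrans GkerE ?enorm_ge0// alE addrK. Qed.

Lemma Re_sumr N (F : 'I_N -> R[i]) :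
  complex.Re (\sum_j F j) = \sum_j complex.Re (F j).
Proof. by apply: (big_morph _ (id1 := 0)) => // -[a b] [a' b']. Qed.

Lemma Im_sumr N (F : 'I_N -> R[i]) :
  complex.Im (\sum_j F j) = \sum_j complex.Im (F j).
Proof. by apply: (big_morph _ (id1 := 0)) => // -[a b] [a' b']. Qed.

(** Multiplied by [gammaE al], the Fourier transform of the kernel at frequency 0. *)
Definition Ghat0 := Gcst n al * Num.sqrt (4 * pi) ^+ n.
Local Notation G0 := Ghat0.

Let G0_gt0 : 0 < G0.
Proof. by rewrite mulr_gt0 ?Gcst_gt0// exprn_gt0// sqrtr_gt0 mulr_gt0 ?pi_gt0. Qed.

Lemma fourier_lincomb N (c : nat -> R[i]) xi :
  fourier (lincomb N c f) xi =
  Complex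
   (G0 * ((1 + dotn xi xi) `^ (- al) * gammaE al) *
    \sum_(j < N) (complex.Re (c j) * cos (dotn xi (xs j)) +
                  complex.Im (c j) * sin (dotn xi (xs j))))
   (G0 * ((1 + dotn xi xi) `^ (- al) * gammaE al) *
    \sum_(j < N) (complex.Im (c j) * cos (dotn xi (xs j)) -
                  complex.Re (c j) * sin (dotn xi (xs j)))).
Proof.
rewrite /fourier; congr Complex.
  have H := iint_bpot_trig (fun j : 'I_N => Gcst n al * complex.Re (c j))
    (fun j => Gcst n al * complex.Im (c j)) (fun=> xi) (fun j => xs j).
  have -> : (fun x => (complex.Re (expmi (dotn xi x) * lincomb N c f x))%:E) =
    (fun x => (\sum_(i < N) (Gcst n al * complex.Re (c i) * cos (dotn xi x) +
         Gcst n al * complex.Im (c i) * sin (dotn xi x)) *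
        bpot nu (enorm (tsub x (xs i))))%:E).
    apply/funext => x; congr EFin; rewrite /lincomb mulr_sumr Re_sumr.
    apply: eq_bigr => j _; rewrite fE.
    by case: (c j) => a b /=; ring.
  rewrite H /= mulr_sumr; apply: eq_bigr => j _; rewrite /Ghat0; ring.
have H := iint_bpot_trig (fun j : 'I_N => Gcst n al * complex.Im (c j))
    (fun j => - (Gcst n al * complex.Re (c j))) (fun=> xi) (fun j => xs j).
have -> : (fun x => (complex.Im (expmi (dotn xi x) * lincomb N c f x))%:E) =
    (fun x => (\sum_(i < N) (Gcst n al * complex.Im (c i) * cos (dotn xi x) +
         - (Gcst n al * complex.Re (c i)) * sin (dotn xi x)) *
        bpot nu (enorm (tsub x (xs i))))%:E).
  apply/funext => x; congr EFin; rewrite /lincomb mulr_sumr Im_sumr.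
  apply: eq_bigr => j _; rewrite fE.
  by case: (c j) => a b /=; ring.
by rewrite H /= mulr_sumr; apply: eq_bigr => j _; rewrite /Ghat0; ring.
Qed.

(** The squared modulus of [sum_j c_j e^(- i xi.x_j)]. *)
Definition sqr_cis N (c : nat -> R[i]) (xi : n.-tuple R) :=
  (\sum_(j < N) (complex.Re (c j) * cos (dotn xi (xs j)) +
                  complex.Im (c j) * sin (dotn xi (xs j)))) ^+ 2 +
  (\sum_(j < N) (complex.Im (c j) * cos (dotn xi (xs j)) -
                  complex.Re (c j) * sin (dotn xi (xs j)))) ^+ 2.

Local Notation P2 := sqr_cis.

Let P2_ge0 N c xi : 0 <= P2 N c xi.
Proof. by rewrite addr_ge0 ?sqr_ge0. Qed.

Lemma cabs2_fourier_lincomb N (c : nat -> R[i]) xi :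
  cabs2 (fourier (lincomb N c f) xi) * (1 + enorm xi ^+ 2) `^ al =
  P2 N c xi * (G0 ^+ 2 * gammaE al ^+ 2 * (1 + dotn xi xi) `^ (- al)).
Proof.
rewrite fourier_lincomb /cabs2/= enorm_sqr /sqr_cis.
have d0 : 0 < 1 + dotn xi xi by rewrite ltr_pwDl ?dotnn_ge0.
rewrite powRN; have : (1 + dotn xi xi) `^ al != 0 by rewrite gt_eqF ?powR_gt0.
by move: (_ `^ al) => l l0; field.
Qed.

Definition cdot (c : nat -> R[i]) (j k : nat) :=
  complex.Re (c j) * complex.Re (c k) + complex.Im (c j) * complex.Im (c k).

(** The Sobolev weight cancels one of the two factors [(1 + |xi|^2)^-al]. The other is a mixture
    with rate [exp u], and transforming it brings back [bpot nu]: the Gram matrix is the kernel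
    itself at the differences of points, up to a constant. *)
Lemma Hnorm2_lincomb N (c : nat -> R[i]) :
  Hnorm2 al (lincomb N c f) =
  ((2 * pi) ^- n * (G0 ^+ 2 * gammaE al * Num.sqrt pi ^+ n *
   \sum_(j < N) \sum_(k < N) cdot c j k * bpot nu (enorm (tsub (xs j) (xs k)))))%:E.
Proof.
rewrite /Hnorm2 [RHS]EFinM; congr (_ * _)%E.
pose W (u : R) := G0 ^+ 2 * gammaE al * expR (al * u - expR u).
have mW : measurable_fun [set: R] W.
  by apply: measurable_funM => //; exact: measurable_gamma_fun1.
have iW : mu.-integrable setT (EFin \o W).
  by apply: integrableR_Zl; exact: integrable_gamma_fun1.
have sW u : W u * Num.sqrt (pi / expR u) ^+ n =
    G0 ^+ 2 * gammaE al * Num.sqrt pi ^+ n * expR (nu * u - expR u).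
  rewrite /W sqrt_pi_expR alE.
  have -> : nu * u - expR u = (nu + n%:R / 2) * u - expR u + - (n%:R / 2 * u) by ring.
  by rewrite [in RHS]expRD; ring.
have iWs : mu.-integrable setT (EFin \o (fun u => W u * Num.sqrt (pi / expR u) ^+ n)).
  under [X in EFin \o X]eq_fun do rewrite sW.
  by apply: integrableR_Zl; exact: integrable_gamma_fun1.
have := iint_sqr_cis_sum (fun j : 'I_N => complex.Re (c j))
  (fun j => complex.Im (c j)) (fun j => xs j) (@measurable_expR R) (@expR_gt0 R) mW iW iWs.
have -> : (fun xi => (cabs2 (fourier (lincomb N c f) xi) * (1 + enorm xi ^+ 2) `^ al)%:E) =
   (fun xi => (P2 N c xi * \int[mu]_u (W u * expR (- (expR u * dotn xi xi))))%:E).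
  apply/funext => xi; rewrite cabs2_fourier_lincomb; congr ((_ * _)%:E).
  have d0 : 0 < 1 + dotn xi xi by rewrite ltr_pwDl ?dotnn_ge0.
  rewrite (_ : G0 ^+ 2 * gammaE al ^+ 2 * _ = G0 ^+ 2 * gammaE al *
    ((1 + dotn xi xi) `^ (- al) * gammaE al)); last by ring.
  rewrite -Rintegral_gamma_scale// -RintegralZl//; last exact: integrable_gamma_fun.
  apply: eq_Rintegral => u _; rewrite /W -(mulrA (G0 ^+ 2 * gammaE al)) -expRD.
  by congr (_ * expR _); ring.
move=> ->; congr EFin; rewrite mulr_sumr; apply: eq_bigr => j _.
rewrite mulr_sumr; apply: eq_bigr => k _; rewrite [RHS]mulrCA; congr (_ * _).
rewrite -RintegralZl//; last exact: integrable_bpot_fun.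
apply: eq_Rintegral => u _; rewrite sW -mulrA -expRD; congr (_ * expR _).
by rewrite enorm_tsub_sqr expRN; field; rewrite gt_eqF ?expR_gt0.
Qed.

(* [(1+d)^-al >= m exp(- eps d)], from [ln y <= y]. *)
Lemma powRN_ge_expR (eps d : R) : 0 < eps -> 0 <= d ->
  expR (al * ln (eps / al) - eps) * expR (- (eps * d)) <= (1 + d) `^ (- al).
Proof.
move=> e0 d0; have l0 : 0 < 1 + d by rewrite ltr_pwDl.
rewrite /powR gt_eqF// -expRD ler_expR.
have ea : 0 < eps / al by exact: divr_gt0 e0 al0.
have := ln_sublinear (mulr_gt0 l0 ea); rewrite [ln ((1 + d) * _)]lnM ?posrE// => H.
have : al * (ln (1 + d) + ln (eps / al)) <= al * ((1 + d) * (eps / al)).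
  by rewrite ler_pM2l// ltW.
have -> : al * ((1 + d) * (eps / al)) = (1 + d) * eps by field; rewrite gt_eqF.
by rewrite mulrDr; lra.
Qed.

Lemma Hnorm2_lincomb_ge (eps : R) : 0 < eps ->
  exists2 C : R, 0 < C & forall N (c : nat -> R[i]),
  ((C * \sum_(j < N) \sum_(k < N) cdot c j k *
          expR (- (sqdist (xs j) (xs k) / (4 * eps))))%:E <=
   Hnorm2 al (lincomb N c f))%E.
Proof.
move=> e0; pose m := expR (al * ln (eps / al) - eps).
have m0 : 0 < m by exact: expR_gt0.
have ga0 := gammaE_gt0 al0.
pose K := G0 ^+ 2 * gammaE al * m.
have K0 : 0 < K.
  by apply: mulr_gt0 => //; apply: mulr_gt0 => //; apply: exprn_gt0; exact: G0_gt0.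
have tp0 : 0 < (2 * pi) ^- n :> R by rewrite invr_gt0 exprn_gt0// mulr_gt0 ?pi_gt0.
exists ((2 * pi) ^- n * (K * gammaE al * Num.sqrt (pi / eps) ^+ n)).
  apply: mulr_gt0 => //; apply: mulr_gt0; first exact: mulr_gt0.
  by apply: exprn_gt0; rewrite sqrtr_gt0 divr_gt0 ?pi_gt0.
move=> N c; rewrite /Hnorm2 -(mulrA ((2 * pi) ^- n)) [leLHS]EFinM lee_pmul2l ?lte_fin//.
(* With the constant rate [eps] the mixture collapses to one Gaussian times the total mass
   [K * gammaE al] of [W]. *)
pose W (u : R) := K * expR (al * u - expR u).
have mW : measurable_fun [set: R] W.
  by apply: measurable_funM => //; exact: measurable_gamma_fun1.
have iW : mu.-integrable setT (EFin \o W).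
  by apply: integrableR_Zl; exact: integrable_gamma_fun1.
have WE k : \int[mu]_u (W u * k) = K * gammaE al * k.
  by rewrite RintegralZr// RintegralZl//; exact: integrable_gamma_fun1.
have iWs : mu.-integrable setT (EFin \o (fun u => W u * Num.sqrt (pi / eps) ^+ n)).
  under [X in EFin \o X]eq_fun do rewrite mulrC.
  exact: integrableR_Zl.
have := @iint_sqr_cis_sum R n N (fun=> eps) W (fun j => complex.Re (c j))
  (fun j => complex.Im (c j)) (fun j => xs j)
  (@measurable_cst _ _ _ _ _ eps) (fun=> e0) mW iW iWs.
have -> : (\sum_(j < N) \sum_(k < N) (complex.Re (c j) * complex.Re (c k) +
    complex.Im (c j) * complex.Im (c k)) *
     \int[mu]_u (W u * Num.sqrt (pi / eps) ^+ n *
                 expR (- (sqdist (xs j) (xs k) / (4 * eps))))) =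
   K * gammaE al * Num.sqrt (pi / eps) ^+ n *
   (\sum_(j < N) \sum_(k < N) cdot c j k * expR (- (sqdist (xs j) (xs k) / (4 * eps)))).
  rewrite mulr_sumr; apply: eq_bigr => j _; rewrite mulr_sumr; apply: eq_bigr => k _.
  rewrite [RHS]mulrCA; congr (_ * _); under eq_Rintegral do rewrite -mulrA.
  by rewrite WE mulrA.
move=> <-; apply: le_iint => xi.
  rewrite lee_fin mulr_ge0 ?P2_ge0//; apply: Rintegral_ge0 => u _.
  apply: mulr_ge0; last exact: expR_ge0.
  by apply: mulr_ge0; [exact: ltW|exact: expR_ge0].
rewrite lee_fin cabs2_fourier_lincomb ler_wpM2l ?P2_ge0// WE.
rewrite (_ : K * gammaE al * _ = G0 ^+ 2 * gammaE al ^+ 2 *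
  (m * expR (- (eps * dotn xi xi)))); last by rewrite /K; ring.
rewrite ler_wpM2l//; last exact: powRN_ge_expR e0 (dotnn_ge0 xi).
by apply: mulr_ge0; exact: sqr_ge0.
Qed.


Lemma measurable_enorm_tsub (a : n.-tuple R) :
  measurable_fun [set: n.-tuple R] (fun x => enorm (tsub x a)).
Proof.
apply: measurable_sqrtR; last by move=> x; exact: sqdist_ge0.
rewrite (_ : (fun x => _) = (fun x => \sum_(i < n) (tnth x i - tnth a i) ^+ 2)).
  apply: measurable_sum => i; apply: measurable_funX; apply: measurable_funB => //.
  exact: measurable_tnth.
by apply/funext => x; rewrite -sqdistE.
Qed.

(** Square integrability: the kernel is bounded, so its square is at most a constant times itself,
    and its integral is the transform at frequency 0. *)
Lemma Gtrans_in_H j : (Hnorm2 al (f j) < +oo)%E -> in_H al (f j).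
Proof.
move=> fH; split => //.
- rewrite (_ : (fun x => _) = (fun x => Gcst n al * bpot nu (enorm (tsub x (xs j))))).
    apply: measurable_funM => //.
    apply: (measurableT_comp _ (measurable_enorm_tsub (xs j))).
    by apply: continuous_measurable_fun; exact: continuous_bpot.
  by apply/funext => x; rewrite fE.
have H := iint_bpot_trig (fun _ : unit => Gcst n al ^+ 2 * gammaE nu) (fun=> 0)
  (fun=> tzero R n) (fun=> xs j).
apply: (@le_lt_trans _ _ (iint (fun x => (\sum_(i : unit) (Gcst n al ^+ 2 * gammaE nu *
    cos (dotn (tzero R n) x) + 0 * sin (dotn (tzero R n) x)) *
                   bpot nu (enorm (tsub x (xs j))))%:E))); last by rewrite H ltry.
apply: le_iint => x; first by rewrite lee_fin addr_ge0 ?sqr_ge0.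
rewrite lee_fin fE /cabs2/= expr0n/= addr0 (big_pred1 tt)//.
rewrite dotnC dotn0 cos0 mulr1 mul0r addr0 exprMn -mulrA ler_wpM2l ?sqr_ge0//.
by rewrite expr2 ler_wpM2r ?bpot_ge0// bpot_le_gammaE.
Qed.

Lemma riesz_seq_Gtrans (del : R) : (0 < n)%N -> 0 < del ->
  (forall j k : nat, j <> k -> del <= enorm (tsub (xs j) (xs k))) ->
  riesz_seq_H al Gtrans.
Proof.
move=> n0 del0 sep.
have cc N (c : nat -> R[i]) : sqsum N c = \sum_(j < N) cdot c j j.
  by apply: eq_bigr => j _; rewrite /cabs2 !expr2.
have cc0 (c : nat -> R[i]) j : 0 <= cdot c j j by rewrite addr_ge0 ?sqr_ge0.
have cjk (c : nat -> R[i]) j k : `|cdot c j k| <= (cdot c j j + cdot c k k) / 2.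
  rewrite /cdot; move: (complex.Re _) (complex.Re _) (complex.Im _) (complex.Im _).
  move=> a a' b b'; have := sqr_ge0 (a - a'); have := sqr_ge0 (b - b').
  have := sqr_ge0 (a + a'); have := sqr_ge0 (b + b').
  by rewrite ler_norml => *; apply/andP; split; nra.
have h0 : 0 < 2^-1 :> R by lra.
(* Rate 1/2 is the decay in [bpot_le_expR], for the upper bound; rate 1 serves the off-diagonal
   Gaussian entries of the lower bound. *)
have [S1 S10 sum1] := separated_sum_expR_le n0 del0 h0 sep.
have [S2 S20 sum2] := separated_sum_expR_le n0 del0 ltr01 sep.
pose Cb := 2^-1 `^ (- nu) * gammaE nu.
have Cb0 : 0 < Cb by rewrite mulr_gt0 ?powR_gt0 ?gammaE_gt0.
pose K := (2 * pi) ^- n * (Ghat0 ^+ 2 * gammaE al * Num.sqrt pi ^+ n).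
have K0 : 0 < K.
  apply: mulr_gt0; first by rewrite invr_gt0 exprn_gt0// mulr_gt0 ?pi_gt0.
  apply: mulr_gt0; last by rewrite exprn_gt0// sqrtr_gt0 pi_gt0.
  by apply: mulr_gt0; [apply: exprn_gt0; exact: G0_gt0|exact: gammaE_gt0].
have upper N (c : nat -> R[i]) :
    (Hnorm2 al (lincomb N c f) <= (K * (Cb * S1) * sqsum N c)%:E)%E.
  rewrite Hnorm2_lincomb lee_fin mulrA -/K -[leRHS]mulrA ler_pM2l// cc.
  apply: le_trans (ler_norm _) _.
  apply: (norm_schur_sum_le (t := fun j k : 'I_N => cdot c j k)
    (g := fun j k : 'I_N => bpot nu (enorm (tsub (xs j) (xs k))))
    (nn := fun j : 'I_N => cdot c j j)).
  - by move=> j k; exact: cjk.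
  - by move=> j k; exact: bpot_ge0.
  - by move=> j k; rewrite enorm_tsubC.
  - by move=> j; exact: cc0.
  - move=> j; apply: le_trans
      (_ : \sum_(k < N) Cb * expR (- (2^-1 * enorm (tsub (xs j) (xs k)))) <= _).
      by apply: ler_sum => k _; rewrite [2^-1 * _]mulrC; exact: bpot_le_expR.
    by rewrite -mulr_sumr ler_pM2l.
split.
  move=> j; apply: Gtrans_in_H.
  (* A translate is a combination with a single coefficient 1, so the upper bound already shows its
     norm finite. *)
  have <- : lincomb j.+1 (fun k => if k == j then 1 else 0) f = f j.
    apply/funext => x; rewrite /lincomb big_ord_recr/= eqxx mul1r big1 ?add0r//.
    by move=> k _; rewrite ltn_eqF ?mul0r.
  by apply: le_lt_trans (upper _ _) _; rewrite ltry.
(* With [L] this large the off-diagonal row sums of [exp(- L |xj - xk|^2)] are at most 1/2. *)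
pose L := (2 * S2 / del + 1) / del.
have L0 : 0 < L by rewrite divr_gt0// addr_gt0// divr_gt0// mulr_gt0.
have L4 : 0 < (4 * L)^-1 by rewrite invr_gt0 mulr_gt0.
have [C C0 lower] := Hnorm2_lincomb_ge L4.
(* The Gaussian matrix with [eps = (4 * L)^-1] has diagonal 1 and off-diagonal form at most half of
   [sqsum], which leaves [C / 2]. Adding [C / 2] to the upper constant secures [A <= B]. *)
exists (C / 2), (C / 2 + K * (Cb * S1)); split.
- by rewrite divr_gt0.
- by rewrite lerDl mulr_ge0 ?(ltW K0)// mulr_ge0// ltW.
move=> N c; split; last first.
  apply: le_trans (upper N c) _; rewrite lee_fin ler_wpM2r//.
    by rewrite cc sumr_ge0.
  by rewrite lerDr divr_ge0 ?(ltW C0).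
apply: le_trans (lower N c); rewrite lee_fin -mulrA ler_pM2l//.
pose g (j k : 'I_N) := if j == k then 0 else expR (- (sqdist (xs j) (xs k) * L)).
have -> : \sum_(j < N) \sum_(k < N) cdot c j k *
    expR (- (sqdist (xs j) (xs k) / (4 * (4 * L)^-1))) =
    sqsum N c + \sum_(j < N) \sum_(k < N) cdot c j k * g j k.
  rewrite cc -big_split; apply: eq_bigr => j _ /=.
  rewrite (bigD1 j)//= [in RHS](bigD1 j)//= /g eqxx mulr0 add0r.
  have -> : sqdist (xs j) (xs j) = 0.
    by rewrite sqdistE big1// => i _; rewrite subrr expr0n.
  rewrite mul0r oppr0 expR0 mulr1; congr (_ + _); apply: eq_bigr => k kj.
  rewrite eq_sym (negbTE kj); congr (_ * expR (- (_ * _))).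
  by field; rewrite gt_eqF.
have : `|\sum_(j < N) \sum_(k < N) cdot c j k * g j k| <= 2^-1 * sqsum N c.
  rewrite cc; apply: norm_schur_sum_le.
  - by move=> j k; exact: cjk.
  - by move=> j k; rewrite /g; case: ifP => // _; exact: expR_ge0.
  - by move=> j k; rewrite /g eq_sym sqdistC.
  - by move=> j; exact: cc0.
  move=> j; apply: (@le_trans _ _ (\sum_(k < N) expR (- (2 * S2)) *
      expR (- (1 * enorm (tsub (xs j) (xs k)))))).
    apply: ler_sum => k _; rewrite /g; case: eqVneq => [_|jk].
      by rewrite mulr_ge0 ?expR_ge0.
    rewrite -expRD ler_expR mul1r -opprD lerN2 -enorm_tsub_sqr.
    have /sep : (j : nat) <> k by move=> /val_inj/eqP; rewrite (negbTE jk).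
    move: (enorm _) => e de.
    (* For [e >= del] this is at least [2 * S2 + e]. The term [e] gives the decay summed by [sum2];
       the factor [exp (- 2 S2)] brings the row sum [S2] below 1/2, since
       [exp (2 S2) >= 1 + 2 S2]. *)
    have -> : e ^+ 2 * L = 2 * S2 * (e / del) ^+ 2 + e * (e / del).
      by rewrite /L; field; rewrite gt_eqF.
    have ed : 1 <= e / del by rewrite ler_pdivlMr ?mul1r.
    have e2 : 1 <= (e / del) ^+ 2 by rewrite expr_ge1// (le_trans ler01 ed).
    have eg : 0 <= e by rewrite (le_trans (ltW del0) de).
    rewrite lerD//; first by rewrite ler_peMr// mulr_ge0// ltW.
    by rewrite ler_peMr.
  rewrite -mulr_sumr (le_trans (ler_wpM2l (expR_ge0 _) (sum2 N j)))//.
  rewrite expRN mulrC ler_pdivrMr ?expR_gt0//.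
  by have := expR_ge1Dx (2 * S2); lra.
by rewrite ler_norml => /andP[+ _]; lra.
Qed.

End Assembly.

Lemma sepdist_le (R : realType) n (xs : nat -> n.-tuple R) (j k : nat) :
  j <> k -> sepdist xs <= enorm (tsub (xs j) (xs k)).
Proof.
move=> jk; apply: ge_inf; last by exists j, k.
by exists 0 => _ [j' [k' [_ ->]]]; exact: enorm_ge0.
Qed.

Theorem theorem6p4 (R : realType) (n : nat) (alpha : R)
  (xs : nat -> n.-tuple R) :
  (0 < n)%N -> n%:R / 2 < alpha -> injective xs -> 0 < sepdist xs ->
  ((2 <= n)%N ->
     riesz_seq_H alpha
       (fun j x => (Gker n alpha (enorm (tsub x (xs j))))%:C%C)) /\
  (n = 1%N ->
     4 * Gamma alpha * Gamma (1 / 2) / Gamma (alpha - 1 / 2) < sepdist xs ->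
     riesz_seq_H alpha
       (fun j x => (Gker n alpha (enorm (tsub x (xs j))))%:C%C)).
Proof.
move=> n0 nal _ sep0.
have H : riesz_seq_H alpha (fun j x => (Gker n alpha (enorm (tsub x (xs j))))%:C%C).
  apply: (@riesz_seq_Gtrans R n (alpha - n%:R / 2) alpha _ _ xs (sepdist xs)) => //.
  - by rewrite subr_gt0.
  - by rewrite subrK.
  - by move=> j k; exact: sepdist_le.
by split.
Qed.
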